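(* For every small fixed constant $c\in(0,1)$ there exist constants $C>0$ and $m_0$, depending only on $c$, such that for every integer $m\ge m_0$ and every integer $N>m^{c}$, $$\max_{\gcd(a,m)=1}\Bigl|\sum_{\substack{n\le N}}e_m(an^* )\Bigr|< \frac{(\log\log m)^{C}}{(\log m)^{1/2}}\,N,$$ where the maximum is over integers $a$ coprime to $m$ and the sum is over positive integers $n\le N$ with $\gcd(n,m)=1$.
   Context: $e_m(z)=e^{2\pi i z/m}$. For an integer $n$ coprime to $m$, $n^*$ denotes the multiplicative inverse of $n$ modulo $m$. *)

(* Defs.v *)
From HB Require Import structures.
From mathcomp Require Import all_boot all_order all_algebra.
From mathcomp Require Import all_classical all_reals all_analysis.
From mathcomp Require Import complex.

Set Implicit Arguments.
Unset Strict Implicit.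
Unset Printing Implicit Defensive.

Import Order.TTheory GRing.Theory Num.Theory.

Local Open Scope ring_scope.

(* The inverse of n modulo m, reduced modulo m: by [egcdn], if egcdn n m =
   (u, v) then n * u = m * v + gcdn n m.  Only meaningful for coprime n and m
   (see [modinvP]). *)
Definition modinv (m n : nat) : nat := ((egcdn n m).1 %% m)%N.

Lemma modinvP (m n : nat) : (0 < n)%N -> coprime n m ->
  (n * modinv m n = 1 %[mod m])%N.
Proof.
move=> n_gt0 /eqP co_nm; rewrite /modinv modnMmr mulnC.
by case: egcdnP => // u v -> _; rewrite co_nm modnMDl.
Qed.

(* e_m(z) = exp (2 pi i z / m), written by Euler's formula. *)
Definition e_ (R : realType) (m : nat) (z : R) : R[i] :=
  let t : R := 2 * pi * z / m%:R in Complex (cos t) (sin t).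

Definition kloosterman_sum (R : realType) (m N : nat) (a : int) : R[i] :=
  \sum_(1 <= n < N.+1 | coprime n m) e_ m ((a * (modinv m n)%:Z)%:~R : R).

(* Main.v *)
(* Write L = ln m and l = ln L. Every n <= N outside a small exceptional set is
   n = w p q, where p is its least prime factor in a set P of primes between
   exp (L^(1/2) l^O(1)) and y = exp (L / l^O(1)), and q > y is its largest prime
   factor. After cutting the range of p into short cells and that of q dyadically,
   the condition w p q <= N decouples, and for each w there remain bilinear sums
   over p and q of e_m (b p^-1 q^-1). Hoelder's inequality with exponents 2k and 2l,
   where X^(2k) and Y^(2l) are close to m for p ~ X and q ~ Y, reduces these to
   counting k-tuples of primes with given sum of inverses modulo m: such sums are
   reductions of rationals sum 1/p_i, which are too well spaced to coincide often
   and determine the set of the p_i. The saving is a power of X unless X^(2k) is almost m for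
   some k; these p are left out of P, which barely changes sum_(p in P) 1/p.
   The exponent 1/2 comes from the exceptional set: by Brun's pure sieve and
   Mertens' estimate, the n without prime factor in P have density about
   exp (- sum_(p in P) 1/p) = L^(-1/2) l^O(1), since log log y - log log (min P) is
   (ln L)/2 + O(ln l). The y-smooth n are much rarer. *)

Require Import Defs.
From mathcomp Require Import all_boot all_order all_algebra.
From mathcomp Require Import all_classical all_reals all_analysis.
From mathcomp Require Import complex.
From mathcomp Require Import zify ring lra.

Set Implicit Arguments.
Unset Strict Implicit.
Unset Printing Implicit Defensive.

Import Order.TTheory GRing.Theory Num.Theory.

Local Open Scope ring_scope.

Local Notation normc := ComplexField.Normc.normc.

(** The lower end of [P] is forced by the size of the tuples. Let [k] be the exponent for [p ~ X],
    with [2 k ln X] about [L], and [r] the one for [q]. A [k]-tuple has up to [k ^ k] companions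
    over the same primes, and a saving [exp (- s)] in the sum becomes [2 k r s] in the exponent
    after raising to the power [2 k r]. All this is paid from [d ln X], where [m] is kept a factor
    [X ^ (2 d)] away from the even powers of [X]. The [q] are too large for their tuples to cost
    much, and no such margin is asked of them. With [r = O(l ^ 2)], [s = 8 l] and [d = 1 / l], [k]
    may grow to about [L ^ (1/2) / l ^ 2]; one more factor [l] is given up for safety.

    The saving [exp (- 8 l) = L ^ (- 8)] has to outweigh about [L ^ 4] cells, [L] dyadic ranges and
    a factor [L] from the sum of [1 / w]. In the final exponent 6 of [l], 3 and 2 come from the two
    ends of [P], and 1 absorbs the numerical constants. *)

(** * Power means *)

(** Chebyshev's sum inequality: the products [(a i - a j) * (a i ^+ n - a j ^+ n)] are nonnegative,
    and their double sum is twice the difference of the two sides. *)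
Lemma chebyshev_sum_pow (R : realType) (I : finType) (a : I -> R) (n : nat) :
  (forall i, 0 <= a i) ->
  (\sum_i a i) * (\sum_i a i ^+ n) <= #|I|%:R * \sum_i a i ^+ n.+1.
Proof.
move=> a0.
have H : 0 <= \sum_i \sum_j (a i - a j) * (a i ^+ n - a j ^+ n).
  apply: sumr_ge0 => i _; apply: sumr_ge0 => j _.
  have [le|/ltW le] := lerP (a i) (a j).
    rewrite -mulrNN mulr_ge0 ?opprB ?subr_ge0 //.
    by rewrite lerXn2r // nnegrE.
  by rewrite mulr_ge0 ?subr_ge0 // lerXn2r // nnegrE.
have E : \sum_i \sum_j (a i - a j) * (a i ^+ n - a j ^+ n) =
   2 * (#|I|%:R * \sum_i a i ^+ n.+1) - 2 * ((\sum_i a i) * (\sum_i a i ^+ n)).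
  transitivity (\sum_i (#|I|%:R * a i ^+ n.+1 + \sum_j a j ^+ n.+1
     - a i * (\sum_j a j ^+ n) - a i ^+ n * \sum_j a j)).
    apply: eq_bigr => i _.
    rewrite mulr_sumr mulr_sumr -sumr_const mulr_suml -!big_split /=.
    rewrite -sumrB -sumrB; apply: eq_bigr => j _.
    by rewrite !exprS mul1r; ring.
  rewrite !sumrB big_split /= -mulr_sumr -!mulr_suml sumr_const.
  by rewrite -[_ *+ _]mulr_natl; ring.
by move: H; rewrite E; lra.
Qed.

(** The only form of Hölder's inequality used below: equal weights and an integer exponent. *)
Lemma power_mean (R : realType) (I : finType) (a : I -> R) (n : nat) :
  (forall i, 0 <= a i) ->
  (\sum_i a i) ^+ n.+1 <= #|I|%:R ^+ n * \sum_i a i ^+ n.+1.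
Proof.
move=> a0; elim: n => [|n IH]; first by rewrite expr0 mul1r.
rewrite exprS; apply: (le_trans (ler_wpM2l _ IH)); first exact: sumr_ge0.
rewrite mulrCA exprSr -mulrA ler_wpM2l ?exprn_ge0 //.
exact: chebyshev_sum_pow.
Qed.

(** * Additive characters and the bilinear estimate *)

Lemma normc_ge0 (R : realType) (z : R[i]) : 0 <= normc z.
Proof. by case: z => x y; exact: sqrtr_ge0. Qed.

Lemma normcX (R : realType) (z : R[i]) n : normc (z ^+ n) = normc z ^+ n.
Proof.
elim: n => [|n IH]; first by rewrite !expr0 ComplexField.Normc.normc1.
by rewrite !exprS ComplexField.Normc.normcM IH.
Qed.

Lemma normc_normr (R : realType) (z : R[i]) : (normc z)%:C%C = `|z|.
Proof. by []. Qed.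

Lemma ler_normcD (R : realType) (x y : R[i]) : normc (x + y) <= normc x + normc y.
Proof. by rewrite -lecR rmorphD /= !normc_normr ler_normD. Qed.

Lemma normc_sum (R : realType) (I : Type) (r : seq I) (P : pred I) (F : I -> R[i]) :
  normc (\sum_(i <- r | P i) F i) <= \sum_(i <- r | P i) normc (F i).
Proof.
apply: (big_ind2 (fun x y => normc x <= y)).
- by rewrite ComplexField.Normc.normc0.
- by move=> x1 x2 y1 y2 H1 H2; apply: le_trans (lerD H1 H2); apply: ler_normcD.
- by [].
Qed.

Lemma Re_le_normc (R : realType) (z : R[i]) : complex.Re z <= normc z.
Proof.
apply: le_trans (ler_norm _) _; rewrite -lecR normc_normr.
exact: normc_ge_Re.
Qed.

Lemma normc_sqr (R : realType) (z : R[i]) : normc z ^+ 2 = complex.Re (z * conjc z).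
Proof. by rewrite -sqr_normc -normc_normr -rmorphXn. Qed.

Lemma normc_conj (R : realType) (z : R[i]) : normc (conjc z) = normc z.
Proof. by apply: complexI; rewrite !normc_normr normcJ. Qed.

Definition ec (R : realType) (m : nat) (z : int) : R[i] := e_ m (z%:~R : R).

Arguments ec : simpl never.

Lemma conjcM (R : realType) (x y : R[i]) : conjc (x * y) = conjc x * conjc y.
Proof. exact: rmorphM. Qed.

Lemma normc_ec (R : realType) m z : normc (ec R m z) = 1.
Proof. by rewrite /ec /e_ /= cos2Dsin2 sqrtr1. Qed.

Lemma ecD (R : realType) m y z : ec R m (y + z) = ec R m y * ec R m z.
Proof.
rewrite /ec /e_ rmorphD /= mulrDr mulrDl cosD sinD.
by apply/eqP; rewrite eq_complex /= eqxx /= addrC.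
Qed.

Lemma ec0 (R : realType) m : ec R m 0 = 1.
Proof. by rewrite /ec /e_ mulr0 mul0r cos0 sin0. Qed.

Lemma ecN (R : realType) m z : ec R m (- z) = conjc (ec R m z).
Proof. by rewrite /ec /e_ /= rmorphN /= mulrN mulNr cosN sinN. Qed.

Lemma ecM (R : realType) m z (n : nat) : ec R m (n%:Z * z) = ec R m z ^+ n.
Proof.
elim: n => [|n IH]; first by rewrite mul0r ec0 expr0.
by rewrite intS mulrDl mul1r ecD IH exprS.
Qed.

Lemma ecm (R : realType) m : (0 < m)%N -> ec R m m%:Z = 1.
Proof.
move=> m0; rewrite /ec /e_ mulrK ?unitfE ?pnatr_eq0 -?lt0n //.
by rewrite mulr_natl cos2pi sin2pi.
Qed.

Lemma ec_mulm (R : realType) m z : (0 < m)%N -> ec R m (m%:Z * z) = 1.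
Proof.
move=> m0; case: z => n.
  by rewrite mulrC ecM ecm // expr1n.
by rewrite NegzE mulrN mulrC ecN ecM ecm // expr1n conjc1.
Qed.

Lemma ec_mod (R : realType) m y z : (0 < m)%N -> (y = z %[mod m])%Z -> ec R m y = ec R m z.
Proof.
move=> m0 /eqP; rewrite eqz_mod_dvd => /dvdzP [q e].
by rewrite -(subrK z y) e ecD mulrC (mulrC q) ec_mulm // mulr1.
Qed.

(** For a representative [n] with [0 < n < m], the real part [cos (2 t)] with [t = pi n / m] equals
    1 only if [sin t = 0], whereas [0 < t < pi]. *)
Lemma ec_eq1 (R : realType) m z : (0 < m)%N -> ec R m z = 1 -> (m %| z)%Z.
Proof.
move=> m0 e1.
have m0' : (m%:Z != 0) by rewrite eqz_nat -lt0n.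
apply/dvdz_mod0P; case E : (z %% m)%Z => [n|n]; last first.
  by have := modz_ge0 z m0'; rewrite E.
have nm : (n < m)%N by rewrite -ltz_nat -E ltz_pmod // ltz_nat.
have {}e1 : ec R m n = 1.
  by rewrite -e1; apply: ec_mod => //; rewrite -E modz_mod.
have [->//|n0] := posnP n.
have mR : (0 : R) < m%:R by rewrite ltr0n.
have : 0 < sin (pi * n%:R / m%:R :> R).
  apply: sin_gt0_pi; rewrite divr_gt0 ?mulr_gt0 ?pi_gt0 ?ltr0n //=.
  by rewrite ltr_pdivrMr // ltr_pM2l ?pi_gt0 // ltr_nat.
move: e1 => /(congr1 (@complex.Re R)); rewrite /ec /e_ /=.
rewrite -pmulrn.
have -> : 2 * pi * n%:R / m%:R = (pi * n%:R / m%:R) *+ 2 :> R.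
  by rewrite -[RHS]mulr_natl; ring.
rewrite cos_mulr2n cos2sin2 => H1 H2.
have : 0 < sin (pi * n%:R / m%:R :> R) ^+ 2 by rewrite exprn_gt0.
move: H1; rewrite mulr2n => H1 H3.
  suff : (0 : R) < 0 by rewrite ltxx.
  by lra.
Qed.

Lemma ec_orthogonal (R : realType) m z : (0 < m)%N ->
  \sum_(x < m) ec R m (x%:Z * z) = if (m %| z)%Z then m%:R else 0.
Proof.
move=> m0; under eq_bigr do rewrite ecM.
case: ifP => H.
  have -> : ec R m z = 1.
    rewrite -(ec0 R m); apply: ec_mod => //.
    by apply/eqP; rewrite eqz_mod_dvd subr0.
  by under eq_bigr do rewrite expr1n; rewrite sumr_const card_ord.
have e1 : ec R m z != 1 by apply/eqP => /(ec_eq1 m0); rewrite H.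
apply: (mulfI (x := ec R m z - 1)); first by rewrite subr_eq0.
by rewrite -subrX1 -ecM ec_mulm // subrr mulr0.
Qed.

(** Orthogonality leaves only the pairs with [s i] and [s j] congruent modulo [m]; each [i] has at
    most [r] partners, and a surviving pair weighs at most [m]. *)
Lemma parseval_le (R : realType) (m : nat) (I : finType) (w : I -> R[i])
    (s : I -> nat) (r : nat) : (0 < m)%N -> (forall i, normc (w i) <= 1) ->
  (forall i, (#|[set j | s j == s i %[mod m]]| <= r)%N) ->
  \sum_(x < m) normc (\sum_i w i * ec R m (x * s i)%N) ^+ 2 <=
    m%:R * #|I|%:R * r%:R.
Proof.
move=> m0 w1 sr; under eq_bigr do rewrite normc_sqr.
rewrite -[X in X <= _](raddf_sum (@complex.Re R)) /=.
have -> : \sum_(x < m) (\sum_i w i * ec R m (x * s i)%N) *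
     conjc (\sum_i w i * ec R m (x * s i)%N) =
   \sum_i \sum_j w i * conjc (w j) *
     (if (m %| (s i)%:Z - (s j)%:Z)%Z then m%:R else 0).
  transitivity (\sum_(x < m) \sum_i \sum_j w i * conjc (w j) *
                 ec R m (x%:Z * ((s i)%:Z - (s j)%:Z))).
    apply: eq_bigr => x _; rewrite rmorph_sum big_distrlr /=.
    apply: eq_bigr => i _; apply: eq_bigr => j _.
    by rewrite conjcM mulrBr ecD ecN !PoszM; ring.
  rewrite exchange_big; apply: eq_bigr => i _ /=.
  rewrite exchange_big; apply: eq_bigr => j _ /=.
  by rewrite -mulr_sumr ec_orthogonal.
apply: le_trans (Re_le_normc _) _; apply: le_trans (normc_sum _ _ _) _.
have -> : m%:R * #|I|%:R * r%:R = \sum_(i : I) (m%:R * r%:R) :> R.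
  by rewrite sumr_const -[RHS]mulr_natl; ring.
apply: ler_sum => i _; apply: le_trans (normc_sum _ _ _) _.
apply: (@le_trans _ _ (\sum_(j | s j == s i %[mod m]) m%:R)); last first.
  rewrite sumr_const -[X in X <= _]mulr_natr ler_wpM2l ?ler0n // ler_nat.
  by rewrite (leq_trans _ (sr i)) // cardsE.
rewrite [leRHS]big_mkcond /=; apply: ler_sum => j _.
rewrite -eqz_mod_dvd !modz_nat eqz_nat (eq_sym (s i %% m)%N).
case: ifP => _; last by rewrite mulr0 ComplexField.Normc.normc0.
rewrite !ComplexField.Normc.normcM normc_conj.
have -> : normc (m%:R : R[i]) = m%:R :> R.
  by apply: complexI; rewrite normc_normr rmorph_nat normr_nat.
rewrite -[leRHS]mul1r ler_wpM2r ?ler0n //.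
by apply: mulr_ile1; rewrite ?normc_ge0.
Qed.

(** Trades the absolute values in a sum for bounded coefficients, so that the order of summation can
    be exchanged. At [z = 0] the phase is taken to be [0]. *)
Lemma unimodular_phase (R : realType) (z : R[i]) :
  exists2 w, normc w <= 1 & (normc z)%:C%C = w * z.
Proof.
have [->|z0] := eqVneq z 0.
  by exists 0; rewrite ?ComplexField.Normc.normc0 ?ler01 // mulr0.
have nz : (normc z)%:C%C != 0 by rewrite normc_normr normr_eq0.
exists ((normc z)%:C%C / z); last by rewrite mulfVK.
have zz : normc z != 0 by apply: contraNneq nz => ->.
rewrite ComplexField.Normc.normcM ComplexField.Normc.normcV.
have -> : normc (normc z)%:C%C = normc z.
  by apply: complexI; rewrite !normc_normr normr_id.
by rewrite divff.
Qed.

Lemma ec_sum (R : realType) m (I : finType) (F : I -> int) :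
  \prod_i ec R m (F i) = ec R m (\sum_i F i).
Proof.
by rewrite (big_morph (ec R m) (@ecD R m) (@ec0 R m)).
Qed.

(* Hölder is used twice: first over [J] with exponent [k], which turns the
   inner sum into a sum over [k]-tuples of [I], then over these tuples with
   exponent [2 l]; completing the latter to all residues leaves a mean value
   of a trigonometric polynomial over the [l]-tuples of [J]. *)
Lemma bilinear_le (R : realType) (m : nat) (I J : finType) (k l : nat)
    (u : I -> nat) (v : J -> nat) (r1 r2 : nat) : (0 < m)%N ->
  (forall f : {ffun 'I_k.+1 -> I}, (#|[set g : {ffun 'I_k.+1 -> I} |
      (\sum_i u (g i))%N == (\sum_i u (f i))%N %[mod m]]| <= r1)%N) ->
  (forall f : {ffun 'I_l.+1 -> J}, (#|[set g : {ffun 'I_l.+1 -> J} |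
      (\sum_i v (g i))%N == (\sum_i v (f i))%N %[mod m]]| <= r2)%N) ->
  normc (\sum_i \sum_j ec R m (u i * v j)%N) ^+ (2 * k.+1 * l.+1) <=
    m%:R * r1%:R * r2%:R * #|I|%:R ^+ (k.+1 * (2 * l).+1) *
    #|J|%:R ^+ (l.+1 * (2 * k).+1).
Proof.
move=> m0 H1 H2; set S := \sum_i _.
pose F j := \sum_i ec R m (u i * v j)%N.
pose su (f : {ffun 'I_k.+1 -> I}) := (\sum_i u (f i))%N.
pose sv (f : {ffun 'I_l.+1 -> J}) := (\sum_i v (f i))%N.
have [th th1 thE] : exists2 th : J -> R[i], forall j, normc (th j) <= 1 &
    forall j, (normc (F j ^+ k.+1))%:C%C = th j * F j ^+ k.+1.
  have /fin_all_exists2[th h1 h2] : forall j, exists2 w, normc w <= 1 &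
    (normc (F j ^+ k.+1))%:C%C = w * F j ^+ k.+1 by move=> j; apply: unimodular_phase.
  by exists th.
pose G (x : nat) := \sum_j th j * ec R m (x * v j)%N.
have FX j : F j ^+ k.+1 = \sum_(f : {ffun 'I_k.+1 -> I}) ec R m (su f * v j)%N.
  rewrite -[k.+1 in LHS]card_ord -prodr_const /F.
  rewrite (bigA_distr_bigA (fun _ i => ec R m (u i * v j)%N)).
  apply: eq_bigr => f _; rewrite ec_sum; congr ec.
  by rewrite /su big_distrl /= (big_morph Posz PoszD (erefl _)).
have GX x : G x ^+ l.+1 =
    \sum_(f : {ffun 'I_l.+1 -> J}) (\prod_i th (f i)) * ec R m (x * sv f)%N.
  rewrite -[l.+1 in LHS]card_ord -prodr_const /G.
  rewrite (bigA_distr_bigA (fun _ j => th j * ec R m (x * v j)%N)).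
  apply: eq_bigr => f _; rewrite big_split ec_sum; congr (_ * ec _ _ _).
  by rewrite /sv big_distrr /= (big_morph Posz PoszD (erefl _)).
have S1 : normc S <= \sum_j normc (F j).
  by rewrite /S exchange_big; apply: normc_sum.
have S2 : normc S ^+ k.+1 <= #|J|%:R ^+ k * \sum_f normc (G (su f)).
  apply: (@le_trans _ _ ((\sum_j normc (F j)) ^+ k.+1)).
    by rewrite lerXn2r // nnegrE ?normc_ge0 // sumr_ge0 // => j _; apply: normc_ge0.
  apply: le_trans (power_mean _ _) _; first by move=> j; apply: normc_ge0.
  rewrite ler_wpM2l ?exprn_ge0 ?ler0n //.
  under eq_bigr do rewrite -normcX.
  have E : (\sum_j normc (F j ^+ k.+1))%:C%C = \sum_f G (su f).
    rewrite rmorph_sum /=; under eq_bigr do rewrite thE FX mulr_sumr.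
    by rewrite exchange_big.
  apply: le_trans (Re_le_normc (\sum_j normc (F j ^+ k.+1))%:C%C) _.
  by rewrite E; apply: normc_sum.
have Gmod x : normc (G (x %% m)%N) = normc (G x).
  congr normc; apply: eq_bigr => j _; congr (_ * _).
  by apply: ec_mod => //; rewrite !modz_nat modnMml.
(* Thus [n.+1] is the even exponent [2 * l.+1], and Parseval applies to the square of
   [G x ^+ l.+1]. *)
pose n := (2 * l).+1.
have S3 : \sum_f normc (G (su f)) ^+ n.+1 <= r1%:R * \sum_(x < m) normc (G x) ^+ n.+1.
  rewrite (partition_big (fun f => Ordinal (ltn_pmod (su f) m0)) xpredT) //=.
  rewrite mulr_sumr; apply: ler_sum => x _.
  under eq_bigr => f /eqP fx do rewrite -Gmod -[(su f %% m)%N]/(val (Ordinal (ltn_pmod (su f) m0))) fx.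
  rewrite sumr_const -[X in X <= _]mulr_natl ler_wpM2r ?exprn_ge0 ?normc_ge0 // ler_nat.
  case: (pickP (fun f => Ordinal (ltn_pmod (su f) m0) == x)) => [f /eqP fx|e0].
    apply: leq_trans (H1 f); apply/subset_leq_card/fintype.subsetP => g.
    rewrite unfold_in /= => /eqP gx; rewrite inE; apply/eqP.
    by rewrite gx -fx.
  by rewrite eq_card0 // => f; rewrite unfold_in /= e0.
have S4 : \sum_(x < m) normc (G x) ^+ n.+1 <= m%:R * (#|J|%:R ^+ l.+1) * r2%:R.
  have -> : #|J|%:R ^+ l.+1 = #|{ffun 'I_l.+1 -> J}|%:R :> R.
    by rewrite card_ffun card_ord natrX.
  under eq_bigr => x _.
    have -> : n.+1 = (l.+1 * 2)%N by rewrite /n; lia.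
    rewrite exprM -normcX GX.
    over.
  apply: parseval_le => // f.
  elim/big_ind : _ => //; first by rewrite ComplexField.Normc.normc1.
  by move=> x y x1 y1; rewrite ComplexField.Normc.normcM mulr_ile1 ?normc_ge0.
have -> : (2 * k.+1 * l.+1 = k.+1 * n.+1)%N by rewrite /n; lia.
rewrite exprM.
apply: (@le_trans _ _ ((#|J|%:R ^+ k * \sum_f normc (G (su f))) ^+ n.+1)).
  rewrite lerXn2r // nnegrE ?exprn_ge0 ?normc_ge0 // mulr_ge0 ?exprn_ge0 ?ler0n //.
  by apply: sumr_ge0 => f _; apply: normc_ge0.
rewrite exprMn -exprM.
apply: (@le_trans _ _ (#|J|%:R ^+ (k * n.+1) *
   (#|{ffun 'I_k.+1 -> I}|%:R ^+ n * (r1%:R * (m%:R * #|J|%:R ^+ l.+1 * r2%:R))))).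
  rewrite ler_wpM2l ?exprn_ge0 ?ler0n //.
  apply: le_trans (power_mean _ _) _; first by move=> f; apply: normc_ge0.
  rewrite ler_wpM2l ?exprn_ge0 ?ler0n //.
  by apply: le_trans S3 _; rewrite ler_wpM2l ?ler0n.
rewrite card_ffun card_ord natrX -exprM.
have -> : (l.+1 * (2 * k).+1 = k * n.+1 + l.+1)%N by rewrite /n; lia.
by rewrite exprD le_eqVlt; apply/orP; left; apply/eqP; rewrite -/n; ring.
Qed.

(** * Sums of inverses of primes modulo m *)

Lemma card_partition_le (T U : finType) (A : {set T}) (h : T -> U) (c : nat) :
  (forall g, g \in A -> (#|[set g' in A | h g' == h g]| <= c)%N) ->
  (#|A| <= #|U| * c)%N.
Proof.
move=> H; rewrite -sum1_card (partition_big h xpredT) //=.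
rewrite -sum_nat_const; apply: leq_sum => b _.
rewrite sum1dep_card.
case: (pickP (fun g => (g \in A) && (h g == b))) => [g /andP[gA /eqP <-]|e0].
  by apply: leq_trans (H g gA); apply/subset_leq_card/fintype.subsetP => x; rewrite !inE.
by rewrite eq_card0 // => x; rewrite inE e0.
Qed.

(** Both sides are sums of the [1 / p j] over a tuple, times the product of all the primes. If [p j]
    occurred in [g] only, it would divide the left side and every term on the right belonging to
    another prime. The remaining terms equal the product of the other primes, repeated between 1 and
    [k] times, and [p j > k] does not divide their sum. *)
Lemma sum_inv_primes_codom (I : finType) (p : I -> nat) (k : nat)
    (f g : {ffun 'I_k -> I}) :
  injective p -> (forall i, prime (p i)) -> (forall i, (k < p i)%N) ->
  (\sum_i \prod_(j | j != f i) p j = \sum_i \prod_(j | j != g i) p j)%N ->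
  forall i, g i \in codom f.
Proof.
move=> pI pp kp e i; apply/negPn/negP => gif; set j := g i in gif.
pose P a := (\prod_(j | j != a) p j)%N.
have dP a : a != j -> (p j %| P a)%N.
  by move=> aj; rewrite /P (bigD1 j) 1?eq_sym //= dvdn_mulr.
have : (p j %| \sum_i P (g i))%N.
  rewrite -e; apply: dvdn_sum => i' _; apply: dP.
  by apply: contra gif => /eqP <-; apply: codom_f.
rewrite (bigID (fun i' => g i' == j)) /= dvdn_addl; last first.
  by apply: dvdn_sum => i' ?; apply: dP.
rewrite (eq_bigr (fun=> P j)) => [|i' /eqP -> //].
rewrite sum_nat_const Euclid_dvdM //; apply/negP; rewrite negb_or; apply/andP; split.
  have c0 : (0 < #|[pred i' | g i' == j]|)%N.
    by apply/card_gt0P; exists i; rewrite inE.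
  have ck : (#|[pred i' | g i' == j]| < p j)%N.
    by apply: leq_ltn_trans (max_card _) _; rewrite card_ord.
  by rewrite gtnNdvd.
rewrite /P Euclid_dvd_prod // big_has_cond; apply/hasPn => a _ /=.
apply/negP => /andP[aj]; rewrite dvdn_prime2 // => /eqP /pI eja.
by rewrite eja eqxx in aj.
Qed.

(** This is [a / b < a' / b' + 1], cleared of denominators. *)
Lemma eq_divn_lt (a b a' b' : nat) : (0 < b)%N -> (0 < b')%N ->
  (a %/ b = a' %/ b')%N -> (a * b' < a' * b + b * b')%N.
Proof.
move=> b0 b'0 e.
have h1 : (a < (a %/ b).+1 * b)%N by rewrite ltn_ceil.
have h2 : (a' %/ b' * b' <= a')%N by rewrite leq_trunc_div.
have h1' : (a * b' < (a %/ b).+1 * b * b')%N by rewrite ltn_pmul2r.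
have h2' : (a' %/ b' * b' * b <= a' * b)%N by rewrite leq_pmul2r.
by rewrite e in h1'; nia.
Qed.

(* The sums [\sum_i 1 / p (g i)] attached to the tuples [g] of one residue
   class are rationals with denominator at most [x ^ k]; two distinct ones differ by at
   least [m / x ^ (2 * k)], and equal ones involve the same primes. *)
Lemma fibre_sum_inv_le (I : finType) (p v : I -> nat) (k m x y : nat)
    (f : {ffun 'I_k -> I}) :
  (0 < m)%N -> (0 < y)%N ->
  injective p -> (forall i, prime (p i)) -> (forall i, (k < p i)%N) ->
  (forall i, (y <= p i <= x)%N) -> (forall i, p i * v i = 1 %[mod m])%N ->
  (#|[set g : {ffun 'I_k -> I} |
     (\sum_i v (g i))%N == (\sum_i v (f i))%N %[mod m]]| <=
     ((k * x ^ (2 * k)) %/ (m * y)).+1 * k ^ k)%N.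
Proof.
move=> m0 y0 pI pp kp pyx pv.
pose D (g : {ffun 'I_k -> I}) := (\prod_i p (g i))%N.
pose N (g : {ffun 'I_k -> I}) := (\sum_i \prod_(j | j != i) p (g j))%N.
pose B := ((k * x ^ (2 * k)) %/ (m * y))%N.
(* [N g / D g] is the sum of the [1 / p (g i)]; [h g] numbers the cell of length [m / x ^ (2 * k)]
   that contains it. *)
pose h (g : {ffun 'I_k -> I}) := ((N g * x ^ (2 * k)) %/ (D g * m))%N.
have D0 g : (0 < D g)%N by apply: prodn_gt0 => i; rewrite prime_gt0.
have Dx g : (D g <= x ^ k)%N.
  rewrite /D -[k in (x ^ k)%N]card_ord -prod_nat_const.
  by apply: leq_prod => i _; case/andP: (pyx (g i)).
have DE g i : (D g = p (g i) * \prod_(j | j != i) p (g j))%N by rewrite /D (bigD1 i).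
have hB g : (h g < B.+1)%N.
  rewrite ltnS /B leq_divRL ?muln_gt0 ?m0 //.
  have NyD : (N g * y <= k * D g)%N.
    rewrite /N big_distrl /= -[k in (k * _)%N]card_ord -sum_nat_const.
    apply: leq_sum => i _; rewrite (DE g i) mulnC leq_mul2r.
    by case/andP: (pyx (g i)) => ->; rewrite orbT.
  have := leq_trunc_div (N g * x ^ (2 * k)) (D g * m).
  rewrite -/(h g) => h1.
  have {}h1 : (h g * (D g * m) * y <= k * D g * x ^ (2 * k))%N.
    apply: leq_trans (leq_mul h1 (leqnn y)) _.
    by rewrite mulnAC leq_mul2r NyD orbT.
  by rewrite -(leq_pmul2l (D0 g)); by move: h1; set X := (x ^ _)%N; lia.
have D1 (g : {ffun 'I_k -> I}) i : (\prod_(j | j != i) p (g j) = D g * v (g i) %[mod m])%N.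
  by rewrite (DE g i) mulnAC -modnMml pv modnMml mul1n.
have ND g : (N g = D g * \sum_i v (g i) %[mod m])%N.
  rewrite /N big_distrr /= -modn_summ -[RHS]modn_summ; congr (_ %% _)%N.
  by apply: eq_bigr => i _; apply: D1.
pose A := [set g : {ffun 'I_k -> I} |
     (\sum_i v (g i))%N == (\sum_i v (f i))%N %[mod m]].
rewrite -/A -/B.
have NDA g g' : g \in A -> g' \in A -> (N g * D g' = N g' * D g %[mod m])%N.
  rewrite !inE => /eqP e /eqP e'.
  have step g1 g2 : (N g1 * D g2 = D g1 * D g2 * \sum_i v (g1 i) %[mod m])%N.
    by rewrite -modnMml ND modnMml mulnAC.
  rewrite (step g g') (step g' g) -modnMmr e -e' modnMmr.
  by rewrite (mulnC (D g')).
have inj g g' : g \in A -> g' \in A -> h g = h g' -> (N g * D g' = N g' * D g)%N.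
  wlog le : g g' / (N g' * D g <= N g * D g')%N.
    move=> W gA g'A e; case/orP: (leq_total (N g' * D g) (N g * D g'))%N => H.
      exact: W.
    by apply/esym; apply: W.
  move=> gA g'A e; apply/eqP; rewrite eqn_leq le andbT leqNgt; apply/negP => lt.
  have d1 : (m <= N g * D g' - N g' * D g)%N.
    by apply: dvdn_leq; rewrite ?subn_gt0 // -eqn_mod_dvd //; apply/eqP/NDA.
  have := eq_divn_lt _ _ e; rewrite !muln_gt0 !D0 m0 => /(_ isT isT).
  have Dg := Dx g; have Dg' := Dx g'.
  have : (D g * D g' <= x ^ (2 * k))%N by rewrite mul2n -addnn expnD leq_mul.
  have d2 : (m + N g' * D g <= N g * D g')%N by move: d1 le; lia.
  move=> h1 h2.
  have : (x ^ (2 * k) * (N g * D g') < x ^ (2 * k) * (N g' * D g) + D g * D g' * m)%N.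
    by rewrite -(ltn_pmul2r m0); move: h2; set X := (x ^ _)%N; lia.
  apply/negP; rewrite -leqNgt.
  apply: leq_trans (_ : x ^ (2 * k) * (N g' * D g) + x ^ (2 * k) * m <= _)%N.
    by rewrite leq_add2l leq_mul2r h1 orbT.
  by rewrite -mulnDr leq_mul2l addnC d2 orbT.
apply: leq_trans (_ : #|'I_B.+1| * k ^ k <= _)%N; last by rewrite card_ord.
apply: (@card_partition_le _ _ _ (fun g => Ordinal (hB g))) => g gA.
apply: (@leq_trans #|[pred h : {ffun 'I_k -> I} | h \in ffun_on (mem (codom g))]|); last first.
  rewrite card_ffun_on card_ord.
  have mono a b e : (a <= b -> a ^ e <= b ^ e)%N.
    by move=> ab; case: e => // e; rewrite leq_exp2r.
  by apply: mono; apply: leq_trans (leq_image_card _ _) _; rewrite card_ord.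
apply/subset_leq_card/fintype.subsetP => g' /setIdP[g'A /eqP/(congr1 val)/= e].
rewrite inE.
apply/ffun_onP => i; apply: (sum_inv_primes_codom pI pp kp).
(* Over the common denominator [P] the numerators become the sums compared in
   [sum_inv_primes_codom]. *)
pose Q a := (\prod_(j | j != a) p j)%N; pose P := (\prod_j p j)%N.
have NP g0 : (N g0 * P = D g0 * \sum_i Q (g0 i))%N.
  rewrite /N big_distrl big_distrr /=; apply: eq_bigr => i0 _.
  by rewrite (DE g0 i0) /P (bigD1 (g0 i0)) //= -/(Q (g0 i0)); lia.
apply/eqP; rewrite -/(Q _) -(eqn_pmul2l (D0 g')) -(eqn_pmul2l (D0 g)).
have := inj _ _ gA g'A (esym e).
have := NP g; have := NP g'; rewrite -/(Q _).
set a := (\sum_i Q (g i))%N; set b := (\sum_i Q (g' i))%N => h1 h2 h3.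
have e1 := congr1 (muln (D g')) h2; have e2 := congr1 (muln (D g)) h1.
by have e3 := congr1 (muln P) h3; apply/eqP; lia.
Qed.

(** * Mertens' estimate *)

Lemma prod_primes_dvdn (s : seq nat) (N : nat) :
  uniq s -> (forall p, p \in s -> prime p && (p %| N)%N) ->
  (\prod_(p <- s) p %| N)%N.
Proof.
elim: s => [|p s IH] /=; first by rewrite big_nil dvd1n.
move=> /andP[ps us] H; rewrite big_cons Gauss_dvd.
  have /andP[_ ->] := H p (mem_head _ _).
  by apply: IH => // q qs; apply: H; rewrite inE qs orbT.
have /andP[pp _] := H p (mem_head _ _).
rewrite prime_coprime // Euclid_dvd_prod // big_has; apply/hasPn => q qs.
have /andP[pq _] : prime q && (q %| N)%N by apply: H; rewrite inE qs orbT.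
by rewrite dvdn_prime2 //; apply: contraNneq ps => ->.
Qed.

Lemma prime_dvdn_fact (p n : nat) : prime p -> (p %| n`!)%N = (p <= n)%N.
Proof.
move=> pp; apply/idP/idP => [|le]; last by rewrite dvdn_fact // prime_gt0.
elim: n => [|n IH]; first by rewrite fact0 Euclid_dvd1.
by rewrite factS Euclid_dvdM // => /orP[/dvdn_leq->//|/IH]; apply: leqW.
Qed.

(** The coefficient occurs twice in the expansion of [2 ^ (2 * k).+1], at [k] and at [k.+1]. *)
Lemma bin_odd_le (k : nat) : ('C((2 * k).+1, k) <= 4 ^ k)%N.
Proof.
have := expnDn 1 1 (2 * k).+1.
under eq_bigr do rewrite !exp1n !muln1.
have k1 : (k < (2 * k).+2)%N by lia.
have k2 : (k.+1 < (2 * k).+2)%N by lia.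
rewrite (bigD1 (Ordinal k1)) //= (bigD1 (Ordinal k2)) /=; last first.
  by rewrite -val_eqE /= eqn_leq ltnn.
have -> : 'C((2 * k).+1, k.+1) = 'C((2 * k).+1, k).
  by rewrite -[LHS]bin_sub; last lia; congr 'C(_, _); lia.
rewrite addn1 expnS expnM -[(2 ^ 2)%N]/4%N; lia.
Qed.

(** Erdős's induction: an even [n > 2] adds no prime, and for [n = 2 k + 1] the primes above [k + 1]
    all divide ['C(n, k)]. *)
Lemma primorial_le (n : nat) : (\prod_(0 <= p < n.+1 | prime p) p <= 4 ^ n)%N.
Proof.
elim/ltn_ind: n => n IH.
have [n2|n2] := leqP n 2.
  case: n n2 {IH} => [|[|[|//]]] _; by rewrite unlock.
have [on|/negPf en] := boolP (odd n); last first.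
  rewrite big_mkcond big_nat_recr //= -big_mkcond.
  have -> : prime n = false.
    by apply/negP => /even_prime [e|]; [rewrite e in n2|rewrite en].
  rewrite muln1; case: n n2 IH {en} => // n _ IH.
  by apply: leq_trans (IH n _) _ => //; rewrite leq_exp2l.
pose k := n./2; have nk : n = (2 * k).+1 by rewrite -[LHS]odd_double_half on -mul2n.
have kn : (k.+1 < n)%N by lia.
rewrite (@big_cat_nat _ _ _ k.+2) //=; last by lia.
have -> : (4 ^ n = 4 ^ k.+1 * 4 ^ k)%N by rewrite -expnD; congr expn; lia.
apply: leq_mul; first exact: IH.
apply: leq_trans (bin_odd_le k); rewrite -big_filter; apply: dvdn_leq.
  by rewrite bin_gt0; lia.
apply: prod_primes_dvdn; first by rewrite filter_uniq // iota_uniq.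
move=> p; rewrite mem_filter mem_index_iota => /andP[pp /andP[p1 p2]].
rewrite pp /=.
have : (p %| 'C((2 * k).+1, k) * (k`! * ((2 * k).+1 - k)`!))%N.
  by rewrite bin_fact ?prime_dvdn_fact //; lia.
rewrite !Euclid_dvdM // !prime_dvdn_fact // => /orP[//|/orP[|]]; lia.
Qed.

Lemma ln_nat_ge0 (R : realType) (n : nat) : 0 <= ln (n%:R : R).
Proof. by case: n => [|n]; [rewrite ln0|rewrite ln_ge0 // ler1n]. Qed.

Lemma ln2_le1 (R : realType) : ln (2 : R) <= 1.
Proof. by rewrite -[2]/(1 + 1); apply: le_ln1Dx; lra. Qed.

Lemma theta_le (R : realType) (n : nat) :
  \sum_(0 <= p < n.+1 | prime p) ln (p%:R : R) <= 2 * n%:R.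
Proof.
have -> : \sum_(0 <= p < n.+1 | prime p) ln (p%:R : R) =
          ln (\prod_(0 <= p < n.+1 | prime p) p)%:R.
  have [_ ->] // : (0 < \prod_(0 <= p < n.+1 | prime p) p)%N /\
    ln (\prod_(0 <= p < n.+1 | prime p) p)%:R = \sum_(0 <= p < n.+1 | prime p) ln (p%:R : R).
  apply: (big_ind2 (fun x y => (0 < x)%N /\ ln x%:R = y)) => [|x1 x2 y1 y2 [p1 e1] [p2 e2]|p pp].
  - by rewrite ln1.
  - by rewrite muln_gt0 p1 p2 natrM lnM ?posrE ?ltr0n // e1 e2.
  - by rewrite prime_gt0.
apply: (@le_trans _ _ (ln ((2 ^+ 2) ^+ n))).
  rewrite ler_ln ?posrE ?exprn_gt0 // ?ltr0n; last first.
    by apply: prodn_cond_gt0 => p /prime_gt0.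
  by rewrite -!natrX ler_nat primorial_le.
rewrite !lnXn ?exprn_gt0 // -[leLHS]mulr_natr ler_wpM2r ?ler0n // -[leLHS]mulr_natl.
by have := ln2_le1 R; lra.
Qed.

Lemma ln_fact_primes (R : realType) (n : nat) :
  ln (n`!%:R : R) = \sum_(0 <= p < n.+1 | prime p) (logn p n`!)%:R * ln p%:R.
Proof.
(* The range of primes is frozen at [n], so that the induction on [j] changes the exponents only. *)
have H : forall j, (j <= n)%N ->
    ln (j`!%:R : R) = \sum_(0 <= p < n.+1 | prime p) (logn p j`!)%:R * ln p%:R.
  elim=> [|j IH] jn.
    by rewrite fact0 ln1 big1 // => p _; rewrite logn1 mul0r.
  rewrite factS natrM lnM ?posrE ?ltr0n ?fact_gt0 // IH; last exact: ltnW.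
  under [RHS]eq_bigr do rewrite lognM ?fact_gt0 // natrD mulrDl.
  rewrite big_split; congr (_ + _).
  rewrite -[in LHS](@partnT j.+1) // (@widen_partn n) //.
  rewrite (_ : \sum_(_ <= _ < _ | _) _ = \sum_(0 <= p < n.+1) (logn p j.+1)%:R * ln (p%:R : R)).
    have [_ ->] // : (0 < \prod_(0 <= p < n.+1) p ^ logn p j.+1)%N /\
      ln (\prod_(0 <= p < n.+1) p ^ logn p j.+1)%N%:R =
      \sum_(0 <= p < n.+1) (logn p j.+1)%:R * ln (p%:R : R).
    apply: (big_ind2 (fun x y => (0 < x)%N /\ ln x%:R = y)) => [|x1 x2 y1 y2 [p1 e1] [p2 e2]|p _].
    - by rewrite ln1.
    - by rewrite muln_gt0 p1 p2 natrM lnM ?posrE ?ltr0n // e1 e2.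
    - case: p => [|p]; first by rewrite lognE /= expn0 ln1 mul0r.
      by rewrite expn_gt0 natrX lnXn ?ltr0n // mulr_natl.
  rewrite [LHS]big_mkcond; apply: eq_bigr => p _.
  by rewrite lognE; case: (prime p); rewrite //= mul0r.
exact: H.
Qed.

Lemma ln_fact_le (R : realType) (n : nat) : ln (n`!%:R : R) <= n%:R * ln n%:R.
Proof.
elim: n => [|n IH]; first by rewrite fact0 ln1 mul0r.
rewrite factS natrM lnM ?posrE ?ltr0n ?fact_gt0 //.
rewrite -[X in _ <= X * _]natr1 mulrDl mul1r addrC lerD2r.
apply: le_trans IH _; rewrite ler_wpM2l ?ler0n //.
case: n => [|n]; first by rewrite ln0 // ln1.
by rewrite ler_ln ?posrE ?ltr0n // ler_nat.
Qed.

Lemma ln_succ_le (R : realType) (n : nat) : (0 < n)%N ->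
  n%:R * (ln (n.+1%:R : R) - ln n%:R) <= 1.
Proof.
move=> n0; have nR : (0 : R) < n%:R by rewrite ltr0n.
rewrite -ln_div ?posrE ?ltr0n // mulrC -ler_pdivlMr // div1r.
have -> : n.+1%:R / n%:R = 1 + n%:R^-1 :> R.
  by rewrite -natr1 mulrDl divff ?gt_eqF // mul1r.
by apply: le_ln1Dx; apply: lt_trans (_ : 0 < _); rewrite ?invr_gt0 ?ltrN10.
Qed.

Lemma ln_fact_ge (R : realType) (n : nat) :
  n%:R * ln n%:R - n%:R <= ln (n`!%:R : R).
Proof.
elim: n => [|n IH]; first by rewrite fact0 ln1 mul0r subr0.
rewrite factS natrM lnM ?posrE ?ltr0n ?fact_gt0 //.
have [->|n0] := posnP n; first by rewrite fact0 ln1; lra.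
have := @ln_succ_le R n n0.
by move: IH; rewrite -natr1; lra.
Qed.

Lemma logn_fact_ge (R : realType) (p n : nat) : prime p -> (0 < n)%N ->
  n%:R / p%:R - 1 <= (logn p n`!)%:R :> R.
Proof.
move=> pp n0; have p0 : (0 : R) < p%:R by rewrite ltr0n prime_gt0.
apply: (@le_trans _ _ (n %/ p)%:R).
  rewrite lerBlDr natr1 ler_pdivrMr // -natrM ler_nat.
  by have := ltn_ceil n (prime_gt0 pp); lia.
rewrite ler_nat logn_fact // big_nat_recl //= expn1; lia.
Qed.

Lemma logn_fact_le (R : realType) (p n : nat) : prime p ->
  (logn p n`!)%:R <= n%:R / (p%:R - 1) :> R.
Proof.
move=> pp; have p1 : (1 : R) < p%:R by rewrite ltr1n prime_gt1.
rewrite logn_fact // natr_sum.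
apply: (@le_trans _ _ (\sum_(1 <= k < n.+1) n%:R / p%:R ^+ k)).
  apply: ler_sum => k _; rewrite ler_pdivlMr ?exprn_gt0 ?ltr0n ?prime_gt0 //.
  by rewrite -natrX -natrM ler_nat leq_trunc_div.
rewrite -mulr_sumr ler_wpM2l //.
have E : (p%:R - 1) * \sum_(1 <= k < n.+1) (p%:R ^+ k)^-1 = 1 - (p%:R ^+ n)^-1 :> R.
  elim: n => [|n IH]; first by rewrite big_geq // mulr0 expr0 invr1 subrr.
  rewrite big_nat_recr //= mulrDr IH exprS.
  have pn : p%:R ^+ n != 0 :> R by rewrite expf_neq0 // gt_eqF //; lra.
  by field; rewrite pn gt_eqF //; lra.
rewrite -(ler_pM2l (x := p%:R - 1)) ?subr_gt0 // E divff ?subr_eq0 ?gt_eqF //.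
Qed.

(** Keeping only the first term of Legendre's formula, [ln n!] is at least [n] times the sum minus
    the sum of [ln p]; the latter gives the constant 2 by [theta_le]. *)
Lemma mertens_le (R : realType) (n : nat) : (0 < n)%N ->
  \sum_(0 <= p < n.+1 | prime p) ln p%:R / p%:R <= ln n%:R + 2 :> R.
Proof.
move=> n0; have nR : (0 : R) < n%:R by rewrite ltr0n.
rewrite -(ler_pM2l nR) mulrDr (mulrC _ 2).
have H : n%:R * \sum_(0 <= p < n.+1 | prime p) ln p%:R / p%:R -
    \sum_(0 <= p < n.+1 | prime p) ln p%:R <= ln (n`!%:R : R).
  rewrite ln_fact_primes mulr_sumr -sumrB; apply: ler_sum => p pp.
  have := @logn_fact_ge R p n pp n0 => /(ler_wpM2r (ln_nat_ge0 R p)).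
  by apply: le_trans; rewrite le_eqVlt; apply/orP; left; apply/eqP; ring.
have := theta_le R n; have := ln_fact_le R n; lra.
Qed.

(** The right side is built to telescope: with [a], [b] the logarithms of [x], [x + 1], the
    induction step is [(x + 1) * (b - a) <= 2]. *)
Lemma sum_ln_div_le (R : realType) (n : nat) :
  \sum_(2 <= k < n.+2) ln k%:R / (k%:R * (k%:R - 1)) <=
    2 - (ln n.+1%:R + 2) / n.+1%:R :> R.
Proof.
elim: n => [|n IH]; first by rewrite big_geq // ln1; lra.
rewrite big_nat_recr //=; apply: le_trans (lerD IH (lexx _)) _.
set a := ln n.+1%:R; set b := ln n.+2%:R.
have n1 : (1 : R) <= n.+1%:R by rewrite ler1n.
have h : n.+1%:R * (b - a) <= 1 by apply: ln_succ_le.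
have ab : a <= b by rewrite ler_ln ?posrE ?ltr0n // ler_nat.
have e : n.+2%:R = n.+1%:R + 1 :> R by rewrite natr1.
rewrite e addrK; set x : R := n.+1%:R in h n1 *.
have x0 : 0 < x by lra.
rewrite -subr_ge0 (_ : _ - _ = ((x + 1) * (a - b) + 2) / (x * (x + 1))); last by field; rewrite !gt_eqF //; lra.
by apply: divr_ge0; nra.
Qed.

(** Legendre's formula is bounded by [n / (p - 1) = n / p + n / (p * (p - 1))]. The constant 3 is 1
    from the lower bound for [ln n!] plus 2 from the convergent sum. *)
Lemma mertens_ge (R : realType) (n : nat) : (0 < n)%N ->
  ln n%:R - 3 <= \sum_(0 <= p < n.+1 | prime p) ln p%:R / p%:R :> R.
Proof.
move=> n0; have nR : (0 : R) < n%:R by rewrite ltr0n.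
have H1 : \sum_(0 <= p < n.+1 | prime p) ln p%:R / (p%:R * (p%:R - 1)) <= 2 :> R.
  apply: (@le_trans _ _ (\sum_(2 <= k < n.+1) ln k%:R / (k%:R * (k%:R - 1)) : R)).
    case: n n0 {nR} => // n _; rewrite (@big_cat_nat _ _ _ 2) //=.
    rewrite [X in X + _ <= _](_ : _ = 0) ?add0r; last by rewrite unlock.
    rewrite [leLHS]big_mkcond; apply: ler_sum_nat => k /andP[k2 _].
    case: ifP => // _; apply: divr_ge0; first exact: ln_nat_ge0.
    by rewrite mulr_ge0 ?subr_ge0 ?ler0n // ler1n ltnW.
  case: n n0 {nR} => // n _; apply: le_trans (sum_ln_div_le _ _) _.
  by rewrite lerBlDr lerDl divr_ge0 ?ler0n // addr_ge0 ?ln_nat_ge0.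
have H2 : ln (n`!%:R : R) <= n%:R *
   (\sum_(0 <= p < n.+1 | prime p) ln p%:R / p%:R +
    \sum_(0 <= p < n.+1 | prime p) ln p%:R / (p%:R * (p%:R - 1))).
  rewrite ln_fact_primes -big_split mulr_sumr; apply: ler_sum => p pp /=.
  apply: le_trans (ler_wpM2r (ln_nat_ge0 R p) (logn_fact_le R n pp)) _.
  have p1 : (1 : R) < p%:R by rewrite ltr1n prime_gt1.
  rewrite le_eqVlt; apply/orP; left; apply/eqP; field.
  by rewrite !gt_eqF //; lra.
have H3 := ln_fact_ge R n.
rewrite -(ler_pM2l nR); nra.
Qed.

(** Difference of the two estimates at the integer parts of [b] and [a]: 6 is 3 + 2 from these, and
    1 for rounding [b] down. *)
Lemma mertens_interval (R : realType) (a b : R) (M : nat) :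
  1 <= a -> a <= b -> b < M%:R ->
  ln b - ln a - 6 <=
    \sum_(0 <= p < M | prime p && (a <= p%:R <= b)) ln p%:R / p%:R.
Proof.
move=> a1 ab bM; have b1 : 1 <= b by apply: le_trans ab.
have a0 : 0 <= a by lra.
have b0 : 0 <= b by lra.
pose na := Num.trunc a; pose nb := Num.trunc b.
have na0 : (0 < na)%N by rewrite truncn_gt0.
have nb0 : (0 < nb)%N by rewrite truncn_gt0.
have naa : na%:R <= a by rewrite -truncn_ge_nat.
have nbb : nb%:R <= b by rewrite -truncn_ge_nat.
have bnb : b < nb.+1%:R by rewrite -truncn_le_nat.
have ana : a < na.+1%:R by rewrite -truncn_le_nat.
have nab : (na <= nb)%N by apply: le_truncn.
have nbM : (nb < M)%N by rewrite -(ltr_nat R); apply: le_lt_trans bM.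
have h1 : ln na%:R <= ln a by rewrite ler_ln ?posrE ?ltr0n //; lra.
have h2 : ln b - 1 <= ln nb%:R.
  have h : ln b <= ln (2 * nb%:R).
    rewrite ler_ln ?posrE ?mulr_gt0 ?ltr0n //; last lra.
    have : (1 : R) <= nb%:R by rewrite ler1n.
    by move: bnb; rewrite -natr1; lra.
  by move: h; rewrite lnM ?posrE ?ltr0n //; have := ln2_le1 R; lra.
have := mertens_le R na0; have := mertens_ge R nb0.
rewrite (@big_cat_nat _ _ _ na.+1) //=.
suff : \sum_(na.+1 <= p < nb.+1 | prime p) ln p%:R / p%:R <=
   \sum_(0 <= p < M | prime p && (a <= p%:R <= b)) ln p%:R / p%:R :> R by lra.
rewrite (@big_cat_nat _ _ _ na.+1 0 M) //=; last exact: leq_ltn_trans nbM.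
rewrite (@big_cat_nat _ _ _ nb.+1 na.+1 M) //=.
have pos (m n : nat) (P : pred nat) : 0 <= \sum_(m <= p < n | P p) ln p%:R / p%:R :> R.
  by apply: sumr_ge0 => p _; rewrite divr_ge0 ?ln_nat_ge0 ?ler0n.
have -> : \sum_(na.+1 <= p < nb.+1 | prime p && (a <= p%:R <= b)) ln p%:R / p%:R =
   \sum_(na.+1 <= p < nb.+1 | prime p) ln p%:R / p%:R :> R.
  apply: congr_big_nat => // p /andP[p1 p2].
  rewrite (_ : a <= _ <= _) ?andbT //; apply/andP; split.
    by apply: le_trans (ltW ana) _; rewrite ler_nat.
  by apply: le_trans nbb; rewrite ler_nat.
have := pos 0 na.+1 (fun p => prime p && (a <= p%:R <= b)).
have := pos nb.+1 M (fun p => prime p && (a <= p%:R <= b)).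
lra.
Qed.

(** * Brun's pure sieve *)

Lemma sum_multiples (V : nmodType) (d N : nat) (F : nat -> V) : (0 < d)%N ->
  \sum_(1 <= n < N.+1 | (d %| n)%N) F n = \sum_(1 <= k < (N %/ d).+1) F (d * k)%N.
Proof.
move=> d0; elim: N => [|N IH]; first by rewrite div0n !big_geq.
rewrite big_mkcond big_nat_recr //= -big_mkcond IH divnS //.
case: ifP => [dN|_]; last by rewrite addr0 add0n.
have e : (d * (N %/ d).+1 = N.+1)%N.
  by have := divnK dN; rewrite divnS // dN add1n mulnC.
by rewrite add1n [RHS]big_nat_recr //= e.
Qed.

(** Lets the sieve recursion pass from a real [x] to [x / p] without a rounding error. *)
Lemma truncn_divn (R : realType) (x : R) (p : nat) : 0 <= x -> (0 < p)%N ->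
  Num.trunc (x / p%:R) = (Num.trunc x %/ p)%N.
Proof.
move=> x0 p0; have pR : (0 : R) < p%:R by rewrite ltr0n.
have xp0 : 0 <= x / p%:R by rewrite divr_ge0 // ltW.
apply/eqP; rewrite eqn_leq; apply/andP; split.
  rewrite truncn_le_nat ltr_pdivrMr // -natrM -truncn_lt_nat //.
  by rewrite ltn_ceil.
rewrite truncn_ge_nat // ler_pdivlMr // -natrM -truncn_ge_nat //.
exact: leq_trunc_div.
Qed.

Definition sifted (ps : seq nat) (n : nat) := all (fun p => ~~ (p %| n)%N) ps.

(** Buchstab's identity for one prime: a multiple [p * k] survives sieving by [ps] exactly when [k]
    does, as [p] is not in [ps]. *)
Lemma sifted_cons (p : nat) (ps : seq nat) (N : nat) :
  prime p -> all prime ps -> p \notin ps ->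
  (\sum_(1 <= n < N.+1 | sifted ps n) 1 =
    \sum_(1 <= n < N.+1 | sifted (p :: ps) n) 1 +
    \sum_(1 <= n < (N %/ p).+1 | sifted ps n) 1)%N.
Proof.
move=> pp aps pps; rewrite (bigID (fun n => (p %| n)%N)) /= addnC; congr addn.
  by apply: eq_bigl => n; rewrite andbC.
rewrite (eq_bigl (fun n => (p %| n)%N && sifted ps n)) => [|n]; last by rewrite andbC.
rewrite big_mkcondr (@sum_multiples nat) ?prime_gt0 // [RHS]big_mkcond.
apply: eq_bigr => k _; congr (if _ then _ else _); apply: eq_in_all => q qps.
have pq := allP aps q qps; rewrite Euclid_dvdM // dvdn_prime2 //.
by rewrite (_ : (q == p) = false) //; apply/negP => /eqP e; rewrite -e qps in pps.
Qed.

Lemma prod_sieve_ge0 (R : realType) (ps : seq nat) : all prime ps ->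
  0 <= \prod_(p <- ps) (1 - p%:R^-1 : R).
Proof.
move=> /allP aps; rewrite big_seq; apply: prodr_ge0 => p /aps pp.
by rewrite subr_ge0 invf_le1 ?ltr0n ?ler1n prime_gt0.
Qed.

Lemma prod_sieve_le (R : realType) (ps : seq nat) : all prime ps ->
  \prod_(p <- ps) (1 - p%:R^-1) <= expR (- \sum_(p <- ps) p%:R^-1) :> R.
Proof.
elim: ps => [_|p ps IH /= /andP[pp aps]]; first by rewrite !big_nil oppr0 expR0.
rewrite !big_cons opprD expRD; apply: ler_pM => //.
- by rewrite subr_ge0 invf_le1 ?ltr0n ?ler1n prime_gt0.
- exact: prod_sieve_ge0.
- exact: expR_ge1Dx.
- exact: IH.
Qed.

(* The recursion [|ps| -> |ps| + 1] uses the bound of order [i] for [x] and the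
   one of order [i - 1] for [x / p], which is Brun's truncation; [t] is Rankin's parameter. *)
Lemma brun (R : realType) (t : R) (ps : seq nat) : 0 < t ->
  all prime ps -> uniq ps -> forall (i : nat) (x : R), 0 <= x ->
  `|(\sum_(1 <= n < (Num.trunc x).+1 | sifted ps n) 1)%N%:R
     - x * \prod_(p <- ps) (1 - p%:R^-1)| <=
   x * expR (t * \sum_(p <- ps) p%:R^-1) / t ^+ i + (size ps).+1%:R ^+ i.
Proof.
move=> t0; elim: ps => [|p ps IH].
  move=> _ _ i x x0; rewrite !big_nil mulr0 expR0 !mulr1 expr1n.
  rewrite sum_nat_const_nat subSS subn0 muln1.
  have h1 : (Num.trunc x)%:R <= x by rewrite -truncn_ge_nat.
  have h2 : x < (Num.trunc x)%:R + 1 by rewrite natr1 -truncn_le_nat.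
  have h3 : 0 <= x / t ^+ i by rewrite divr_ge0 // exprn_ge0 // ltW.
  by rewrite ler_norml; apply/andP; split; lra.
move=> /= /andP[pp aps] /andP[pps ups] i x x0.
have pR : (0 : R) < p%:R by rewrite ltr0n prime_gt0.
have xp0 : 0 <= x / p%:R by rewrite divr_ge0 // ltW.
(* Order 0 is the trivial bound: the count and the main term both lie between 0 and [x]. *)
case: i => [|i].
  set ps' := p :: ps.
  have aps' : all prime ps' by rewrite /= pp.
  have h0 := prod_sieve_ge0 R aps'; have := prod_sieve_le R aps'.
  set V := \prod_(j <- ps') _ in h0 *; set s := \sum_(j <- ps') _ => h1.
  have s0 : 0 <= s by apply: sumr_ge0 => q _; rewrite invr_ge0 ler0n.
  have h2 : V <= 1 by apply: le_trans h1 _; rewrite expR_le1; lra.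
  have h3 : 1 <= expR (t * s) by rewrite -expR0 ler_expR mulr_ge0 // ltW.
  have h4 : (\sum_(1 <= n < (Num.trunc x).+1 | sifted ps' n) 1)%N%:R <= x.
    apply: (@le_trans _ _ (Num.trunc x)%:R); last by rewrite -truncn_ge_nat.
    rewrite ler_nat; apply: leq_trans (_ : \sum_(1 <= n < (Num.trunc x).+1) 1 <= _)%N.
      by rewrite big_mkcond; apply: leq_sum => n _; case: ifP.
    by rewrite sum_nat_const_nat muln1 subn1.
  rewrite !expr0 divr1; set c := (\sum_(_ <= _ < _ | _) _)%N%:R in h4 *.
  have c0 : 0 <= c by rewrite ler0n.
  have h5 : x * V <= x by rewrite ler_piMr.
  have h6 : x <= x * expR (t * s) by rewrite ler_peMr.
  have h7 : 0 <= x * V by rewrite mulr_ge0.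
  by rewrite ler_norml; apply/andP; split; lra.
have := sifted_cons (Num.trunc x) pp aps pps.
rewrite -truncn_divn ?prime_gt0 // => /(congr1 (fun n => n%:R : R)).
rewrite natrD !big_cons.
have := IH aps ups i.+1 x x0; have := IH aps ups i _ xp0.
set V := \prod_(j <- ps) _; set s := \sum_(j <- ps) _.
set a := (\sum_(1 <= n < _ | _) 1)%N%:R; set b := (\sum_(1 <= n < _ | _) 1)%N%:R.
set c := (\sum_(1 <= n < _ | sifted (p :: ps) n) 1)%N%:R.
move=> Ha Hb e.
have -> : c - x * ((1 - p%:R^-1) * V) = (b - x * V) - (a - x / p%:R * V).
  by rewrite e; ring.
apply: le_trans (ler_normB _ _) _; apply: le_trans (lerD Hb Ha) _.
(* The terms in [size ps] combine by [y ^+ i.+1 + y ^+ i <= (y + 1) ^+ i.+1], the other two by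
   [1 + t / p <= expR (t / p)]. *)
rewrite addrACA; apply: lerD; last first.
  have h : (0 : R) <= (size ps)%:R by rewrite ler0n.
  rewrite -[(size ps).+2%:R]natr1; set y := (size ps).+1%:R.
  have y0 : 0 <= y by rewrite ler0n.
  rewrite [leRHS]exprS mulrDl mul1r exprS.
  have : y ^+ i <= (y + 1) ^+ i by rewrite lerXn2r // ?nnegrE; lra.
  have : 0 <= y ^+ i by rewrite exprn_ge0.
  nra.
rewrite mulrDr expRD.
have ti : 0 < t ^+ i by rewrite exprn_gt0.
have -> : x * expR (t * s) / t ^+ i.+1 + x / p%:R * expR (t * s) / t ^+ i =
  x * expR (t * s) / t ^+ i.+1 * (1 + t / p%:R).
  by rewrite exprS; field; rewrite !gt_eqF.
have -> : x * (expR (t / p%:R) * expR (t * s)) / t ^+ i.+1 =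
  x * expR (t * s) / t ^+ i.+1 * expR (t / p%:R) by ring.
apply: ler_wpM2l; last exact: expR_ge1Dx.
by rewrite divr_ge0 ?exprn_ge0 ?mulr_ge0 ?expR_ge0 // ltW.
Qed.

(** * Smooth numbers *)

Lemma leq_sum_seq (I : eqType) (r : seq I) (P : pred I) (F G : I -> nat) :
  (forall i, i \in r -> P i -> (F i <= G i)%N) ->
  (\sum_(i <- r | P i) F i <= \sum_(i <- r | P i) G i)%N.
Proof.
move=> H; rewrite big_seq_cond [leqRHS]big_seq_cond.
by apply: leq_sum => i /andP[]; apply: H.
Qed.

Lemma harmonic_le (R : realType) (n : nat) : (0 < n)%N ->
  \sum_(1 <= k < n.+1) k%:R^-1 <= 1 + ln n%:R :> R.
Proof.
case: n => // n _; elim: n => [|n IH].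
  by rewrite big_nat1 invr1 ln1 addr0.
rewrite big_nat_recr //=.
suff : n.+2%:R^-1 <= ln n.+2%:R - ln n.+1%:R :> R.
  by move=> h; apply: le_trans (lerD IH (lexx _)) _; move: h; set u := (n.+2%:R)^-1; lra.
rewrite -ln_div ?posrE ?ltr0n // -[leRHS]opprK -lnV ?posrE ?divr_gt0 ?ltr0n //.
rewrite invf_div lerNr.
have -> : n.+1%:R / n.+2%:R = 1 + - n.+2%:R^-1 :> R.
  have x0 : (0 : R) < n.+1%:R by rewrite ltr0n.
  rewrite -[n.+2%:R]natr1; set x := n.+1%:R in x0 *.
  by field; rewrite gt_eqF //; lra.
by apply: le_ln1Dx; rewrite ltrN2 invf_lt1 ?ltr0n // ltr1n.
Qed.

Lemma harmonic_ge (R : realType) (a b : nat) : (0 < a)%N -> (a <= b)%N ->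
  ln b%:R - ln a%:R <= \sum_(a <= k < b) k%:R^-1 :> R.
Proof.
move=> a0; elim: b => [|b IH]; first by rewrite leqn0 => /eqP ->; rewrite big_geq // subrr.
rewrite leq_eqVlt => /predU1P[->|ab]; first by rewrite big_geq // subrr.
rewrite ltnS in ab; have b0 : (0 < b)%N by apply: leq_trans ab.
have bR : (0 : R) < b%:R by rewrite ltr0n.
rewrite big_nat_recr //=.
have := @ln_succ_le R b b0; rewrite mulrC -ler_pdivlMr // div1r.
by have := IH ab; lra.
Qed.

Lemma sum_size_divisors (R : realType) (N : nat) : (0 < N)%N ->
  (\sum_(1 <= n < N.+1) size (divisors n))%:R <= N%:R * (1 + ln N%:R) :> R.
Proof.
move=> N0.
have -> : (\sum_(1 <= n < N.+1) size (divisors n) = \sum_(1 <= d < N.+1) N %/ d)%N.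
  transitivity (\sum_(1 <= n < N.+1) \sum_(1 <= d < N.+1 | (d %| n)%N) 1)%N.
    apply: eq_big_nat => n /andP[n0 nN]; rewrite sum1_count -size_filter.
    apply: perm_size; apply: uniq_perm; rewrite ?divisors_uniq ?filter_uniq ?iota_uniq //.
    move=> d; rewrite mem_filter mem_index_iota -dvdn_divisors // ; apply/idP/idP => [dn|/andP[]//].
    by rewrite dn (dvdn_gt0 n0 dn) ltnS (leq_trans (dvdn_leq n0 dn)).
  rewrite (exchange_big_dep_nat xpredT) //=; apply: eq_big_nat => d /andP[d0 _].
  by rewrite (@sum_multiples nat) // sum_nat_const_nat muln1 subn1.
rewrite natr_sum; apply: (@le_trans _ _ (\sum_(1 <= d < N.+1) N%:R * d%:R^-1)).
  apply: ler_sum_nat => d /andP[d0 _]; rewrite ler_pdivlMr ?ltr0n //.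
  by rewrite -natrM ler_nat leq_trunc_div.
by rewrite -mulr_sumr ler_wpM2l ?ler0n // harmonic_le.
Qed.

(** With the full power of [p] removed from [n], the divisors [d] of the rest and the numbers
    [p * d] are distinct divisors of [n]: each prime doubles the count. *)
Lemma exp2_primes_le (s : seq nat) (n : nat) : (0 < n)%N -> uniq s ->
  (forall p, p \in s -> prime p && (p %| n)%N) -> (2 ^ size s <= size (divisors n))%N.
Proof.
elim: s n => [|p s IH] n n0 /=.
  by move=> _ _; have := divisors_id n0; case: (divisors n).
move=> /andP[ps us] H.
have /andP[pp pn] : prime p && (p %| n)%N by apply: H; rewrite mem_head.
pose n' := (n %/ p ^ logn p n)%N.
have [n'E n'0 pn'] : [/\ n = (n' * p ^ logn p n)%N, (0 < n')%N & ~~ (p %| n')%N].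
  have d : (p ^ logn p n %| n)%N by apply: pfactor_dvdnn.
  split; first by rewrite divnK.
    have pl0 : (0 < p ^ logn p n)%N by rewrite expn_gt0 prime_gt0.
    by rewrite divn_gt0 //; apply: dvdn_leq.
  apply/negP => /dvdnP [q e].
  have : (p ^ (logn p n).+1 %| n)%N.
    by rewrite -[X in (_ %| X)%N](divnK d) -/n' e expnS -mulnA dvdn_mull.
  by rewrite pfactor_dvdn // ltnn.
have v0 : (0 < logn p n)%N by rewrite logn_gt0 mem_primes pp n0.
have sub d : (d %| n')%N -> (p * d %| n)%N.
  move=> dn'; rewrite n'E mulnC dvdn_mul // -{1}(expn1 p) dvdn_exp2l //.
have IHn' : (2 ^ size s <= size (divisors n'))%N.
  apply: IH => // q qs; have /andP[pq qn] : prime q && (q %| n)%N.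
    by apply: H; rewrite inE qs orbT.
  rewrite pq /=; move: qn; rewrite n'E Euclid_dvdM // => /orP[//|].
  rewrite Euclid_dvdX // dvdn_prime2 // => /andP[/eqP e _].
  by rewrite -e qs in ps.
rewrite expnS mul2n -addnn; apply: leq_trans (leq_add IHn' IHn') _.
rewrite -[X in (_ + X <= _)%N](size_map (muln p)) -size_cat.
apply: uniq_leq_size.
  rewrite cat_uniq divisors_uniq map_inj_uniq ?divisors_uniq ?andbT; last first.
    by move=> a b /eqP; rewrite eqn_pmul2l ?prime_gt0 // => /eqP.
  apply/hasPn => x /mapP [d _ ->]; rewrite -dvdn_divisors //.
  by apply: contra pn' => /(dvdn_trans _); apply; apply: dvdn_mulr.
move=> d; rewrite mem_cat -!dvdn_divisors // => /orP[h|/mapP[x]].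
  by rewrite n'E dvdn_mulr.
by rewrite -dvdn_divisors // => /sub h ->.
Qed.

Definition smooth (y n : nat) := all (fun p => p <= y)%N (primes n).

Lemma smooth_cases (y u n : nat) : (1 < y)%N -> (0 < n)%N -> smooth y n ->
  (y ^ (2 * u) <= n)%N ->
  (2 ^ u <= size (divisors n))%N \/
  exists2 p, (1 < p <= y)%N & (p ^ (trunc_log p (y ^ 2)).+1 %| n)%N.
Proof.
move=> y1 n0 /allP sm yn.
case: (boolP (all (fun p => p ^ logn p n <= y ^ 2)%N (primes n))) => [/allP H|]; last first.
  move=> /allPn [p pn]; rewrite -ltnNge => lt; right.
  have pp : prime p by move: pn; rewrite mem_primes => /andP[].
  exists p; first by rewrite prime_gt1 // sm.
  rewrite pfactor_dvdn //.
  rewrite -(ltn_exp2l _ _ (prime_gt1 pp)); apply: leq_ltn_trans lt.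
  by apply: trunc_logP; [exact: prime_gt1|rewrite expn_gt0 ltnW].
left; apply: leq_trans (_ : 2 ^ size (primes n) <= _)%N; last first.
  apply: exp2_primes_le => //; first exact: primes_uniq.
  by move=> p; rewrite mem_primes => /and3P[-> _ ->].
rewrite leq_exp2l // -(leq_pmul2l (isT : 0 < 2)%N) -(leq_exp2l _ _ y1).
apply: leq_trans yn _; rewrite {1}(prod_prime_decomp n0) prime_decompE big_map /=.
have -> s : (y ^ (2 * size s) = \prod_(p <- s) y ^ 2)%N.
  elim: s => [|p s IH]; first by rewrite big_nil muln0.
  by rewrite big_cons -IH -expnD /= mulnS.
by rewrite big_seq [leqRHS]big_seq; apply: leq_prod => p pn; rewrite H.
Qed.

(** The terms bound the [n] below [y ^ (2 * u)], those with at least [2 ^ u] divisors (Markov's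
    inequality on the divisor sum), and those divisible by one of at most [y] numbers
    [q p > y ^ 2]. *)
Lemma smooth_count_le (R : realType) (y u N : nat) : (1 < y)%N -> (0 < N)%N ->
  (\sum_(1 <= n < N.+1 | smooth y n) 1)%N%:R <=
    y%:R ^+ (2 * u) + N%:R * (1 + ln N%:R) / 2 ^+ u + N%:R / y%:R :> R.
Proof.
move=> y1 N0; pose q p := (p ^ (trunc_log p (y ^ 2)).+1)%N.
have y0 : (0 < y)%N by apply: ltnW.
have S1 : (\sum_(1 <= n < N.+1 | n < y ^ (2 * u)) 1 <= y ^ (2 * u))%N.
  rewrite sum1_count -size_filter; apply: leq_trans (_ : size (iota 0 (y ^ (2 * u))) <= _)%N.
    apply: uniq_leq_size; first by rewrite filter_uniq // iota_uniq.
    by move=> n; rewrite mem_filter mem_iota => /andP[].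
  by rewrite size_iota.
have S2 : (\sum_(1 <= n < N.+1 | 2 ^ u <= size (divisors n)) 1)%N%:R <=
    N%:R * (1 + ln N%:R) / 2 ^+ u :> R.
  rewrite ler_pdivlMr ?exprn_gt0 //; apply: le_trans (sum_size_divisors R N0).
  rewrite -natrX -natrM ler_nat big_distrl /= big_mkcond.
  by apply: leq_sum => n _; case: ifP => //; rewrite mul1n.
have S3 : (\sum_(2 <= p < y.+1) \sum_(1 <= n < N.+1 | q p %| n) 1)%N%:R <= N%:R / y%:R :> R.
  have yR : (0 : R) < y%:R by rewrite ltr0n.
  rewrite natr_sum; apply: (@le_trans _ _ (\sum_(2 <= p < y.+1) N%:R / y%:R ^+ 2)).
    apply: ler_sum_nat => p /andP[p2 _].
    have qy : (y ^ 2 < q p)%N by apply: trunc_log_ltn.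
    rewrite (@sum_multiples nat) ?(leq_trans _ qy) // sum_nat_const_nat muln1 subn1 /=.
    rewrite ler_pdivlMr ?exprn_gt0 // -natrX -natrM ler_nat.
    apply: leq_trans (leq_trunc_div N (q p)); rewrite leq_mul2l.
    by rewrite (ltnW qy) orbT.
  rewrite sumr_const_nat -[leLHS]mulr_natr.
  have h : (y.+1 - 2)%N%:R <= y%:R :> R by rewrite ler_nat; lia.
  apply: le_trans (ler_wpM2l _ h) _; first by rewrite divr_ge0 ?exprn_ge0 ?ler0n.
  by rewrite le_eqVlt; apply/orP; left; apply/eqP; field; rewrite gt_eqF.
have : (\sum_(1 <= n < N.+1 | smooth y n) 1 <=
   \sum_(1 <= n < N.+1 | n < y ^ (2 * u)) 1 +
   \sum_(1 <= n < N.+1 | 2 ^ u <= size (divisors n)) 1 +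
   \sum_(2 <= p < y.+1) \sum_(1 <= n < N.+1 | q p %| n) 1)%N.
  rewrite (exchange_big_dep_nat xpredT) //= !(big_mkcond (fun n => (_ < _)%N)).
  rewrite (big_mkcond (fun n => (2 ^ u <= _)%N)) (big_mkcond (smooth y)) -!big_split /=.
  apply: leq_sum_seq => n; rewrite mem_index_iota => /andP[n0 _] _; case: ifP => // sm.
  case: (ltnP n (y ^ (2 * u))) => // yn; case: (smooth_cases y1 n0 sm yn) => [->//|[p /andP[p1 py] pn]].
  have pi : p \in index_iota 2 y.+1 by rewrite mem_index_iota p1.
  rewrite add0n; apply: leq_trans (leq_addl _ _).
  by rewrite -big_filter (big_rem p) //= mem_filter pi andbT.
rewrite -(ler_nat R) !natrD => H; apply: le_trans H _; apply: lerD => //.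
by apply: lerD => //; rewrite -natrX ler_nat.
Qed.

(** * Decomposition of the sum *)

(** The head of the increasing list [primes n]; [0] is the default when no prime of [n] lies in
    [P]. *)
Definition min_pdiv_in (P : pred nat) (n : nat) := head 0%N ([seq p <- primes n | P p]).

Lemma min_pdiv_inP (P : pred nat) (n : nat) : has P (primes n) ->
  [/\ P (min_pdiv_in P n), min_pdiv_in P n \in primes n &
    forall r, r \in primes n -> P r -> (min_pdiv_in P n <= r)%N].
Proof.
rewrite has_filter /min_pdiv_in.
have := sorted_filter ltn_trans P (sorted_primes n).
case E : ([seq p <- primes n | P p]) => [//|x s] /= sx _.
have : x \in [seq p <- primes n | P p] by rewrite E mem_head.
rewrite mem_filter => /andP[Px xn]; split=> // r rn Pr.
have : r \in [seq p <- primes n | P p] by rewrite mem_filter Pr.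
rewrite E inE => /predU1P[->//|rs].
by apply: ltnW; apply: (allP (order_path_min ltn_trans sx)).
Qed.

Lemma min_pdiv_in_eq (P : pred nat) (n p : nat) : P p -> p \in primes n ->
  (forall r, r \in primes n -> P r -> (p <= r)%N) -> min_pdiv_in P n = p.
Proof.
move=> Pp pn H; have [Pm mn Hm] : [/\ P (min_pdiv_in P n), min_pdiv_in P n \in primes n &
    forall r, r \in primes n -> P r -> (min_pdiv_in P n <= r)%N].
  by apply: min_pdiv_inP; apply/hasP; exists p.
by apply/eqP; rewrite eqn_leq H // Hm.
Qed.

Lemma max_pdiv_eq (n q : nat) : q \in primes n ->
  (forall r, r \in primes n -> (r <= q)%N) -> max_pdiv n = q.
Proof.
move=> qn H; have := qn; rewrite mem_primes => /and3P[pq n0 dq].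
have n1 : (1 < n)%N by apply: leq_trans (prime_gt1 pq) (dvdn_leq n0 dq).
apply/eqP; rewrite eqn_leq H ?mem_primes ?max_pdiv_prime ?n0 ?max_pdiv_dvd //=.
exact: max_pdiv_max.
Qed.

Lemma modinv_uniq (m n x : nat) : (0 < n)%N -> coprime n m ->
  (n * x = 1 %[mod m])%N -> (x = modinv m n %[mod m])%N.
Proof.
move=> n0 co e; have := modinvP n0 co => e'.
rewrite -[in LHS](muln1 x) -modnMmr -e' modnMmr mulnA (mulnC x).
by rewrite -modnMml e modnMml mul1n.
Qed.

Lemma modinvM (m n1 n2 : nat) : (0 < n1)%N -> (0 < n2)%N -> coprime n1 m -> coprime n2 m ->
  (modinv m n1 * modinv m n2 = modinv m (n1 * n2) %[mod m])%N.
Proof.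
move=> h1 h2 c1 c2; apply: modinv_uniq; rewrite ?muln_gt0 ?h1 ?coprimeMl ?c1 //.
by rewrite mulnACA -modnMm !modinvP // modnMm.
Qed.

Lemma coprime_modinv (m n : nat) : (0 < n)%N -> (1 < m)%N -> coprime n m ->
  coprime (modinv m n) m.
Proof.
move=> n0 m1 co; have := modinvP n0 co; rewrite [in RHS]modn_small // => e.
have : coprime ((n * modinv m n) %% m) m by rewrite e coprime1n.
by rewrite coprime_modl coprimeMl => /andP[].
Qed.

Definition outer_part (P : pred nat) (n : nat) :=
  (n %/ (min_pdiv_in P n * max_pdiv n))%N.

Definition well_factored (P : pred nat) (y n : nat) :=
  has P (primes n) && (y < max_pdiv n)%N.

Lemma well_factoredE (P : pred nat) (y n : nat) : (forall p, P p -> (p <= y)%N) ->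
  (0 < n)%N -> well_factored P y n ->
  n = (outer_part P n * min_pdiv_in P n * max_pdiv n)%N /\ (0 < outer_part P n)%N.
Proof.
move=> Py n0 /andP[hP yq]; have [Pp pn _] := min_pdiv_inP hP.
have : (min_pdiv_in P n * max_pdiv n %| n)%N.
  have := pn; rewrite mem_primes => /and3P[pp _ dp].
  rewrite Gauss_dvd ?dp ?max_pdiv_dvd // prime_coprime //.
  have q1 : (1 < max_pdiv n)%N by apply: leq_ltn_trans yq; apply: leq_trans (Py _ Pp); apply: prime_gt0.
  have n1 : (1 < n)%N by apply: leq_trans q1 _; apply: dvdn_leq => //; apply: max_pdiv_dvd.
  rewrite dvdn_prime2 ?max_pdiv_prime //; apply/negP => /eqP e.
  by move: (Py _ Pp); rewrite e leqNgt yq.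
move=> d; have e : n = (outer_part P n * min_pdiv_in P n * max_pdiv n)%N by rewrite -mulnA divnK.
by split=> //; rewrite lt0n; apply: contraTneq n0 => h; rewrite e h.
Qed.

(** For fixed [w], [j], [i] the conditions on [p] here and on [q] in [large_part] are independent,
    so a block is a full rectangle. Since [p <= y < q], minimality of [p] and maximality of [q] need
    testing against the primes of [w] only. *)
Definition small_part (P : pred nat) (m N j w : nat) (cl : nat -> nat) :=
  [seq p <- iota 0 N.+1 | [&& P p, prime p, coprime p m, cl p == j &
     all (fun r => P r ==> (p <= r)%N) (primes w)]].

Definition large_part (y m N i w Q : nat) :=
  [seq q <- iota 0 N.+1 | [&& prime q, (y < q)%N, coprime q m, (q <= Q)%N,
     trunc_log 2 q == i & all (fun r => r <= q)%N (primes w)]].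

(** [Q w j] replaces the joint condition [w * p * q <= N] by one on [q] alone, sufficient for the
    whole cell [j]. The factorisation is unique because [p <= y < q]. *)
Lemma block_sum (V : nmodType) (F : nat -> V) (P : pred nat) (y N m : nat)
    (cl : nat -> nat) (Q : nat -> nat -> nat) (w j i : nat) :
  (forall p, P p -> (p <= y)%N) -> (0 < w)%N -> coprime w m ->
  (forall w p q, (0 < w)%N -> (q <= Q w (cl p))%N -> (w * p * q <= N)%N) ->
  \sum_(1 <= n < N.+1 | [&& coprime n m, well_factored P y n,
      max_pdiv n <= Q (outer_part P n) (cl (min_pdiv_in P n)), outer_part P n == w,
      cl (min_pdiv_in P n) == j & trunc_log 2 (max_pdiv n) == i]%N) F n =
  \sum_(p <- small_part P m N j w cl) \sum_(q <- large_part y m N i w (Q w j)) F (w * p * q)%N.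
Proof.
move=> Py w0 cwm HQ.
rewrite -big_filter; transitivity (\sum_(n <- [seq (w * p * q)%N |
    p <- small_part P m N j w cl, q <- large_part y m N i w (Q w j)]) F n); last first.
  exact: big_allpairs_dep.
apply: perm_big; apply: uniq_perm.
- by rewrite filter_uniq // iota_uniq.
- apply: allpairs_uniq; rewrite ?filter_uniq ?iota_uniq //.
  move=> [p q] [p' q'] /allpairsP[[a b] /= [ha hb [-> ->]]].
  move=> /allpairsP[[a' b'] /= [ha' hb' [-> ->]]] e.
  move: ha hb ha' hb'; rewrite !mem_filter.
  move=> /andP[/and5P[Pa pa _ _ _] _] /andP[/and3P[pb yb _] _].
  move=> /andP[/and5P[Pa' pa' _ _ _] _] /andP[/and3P[pb' yb' _] _].
  have e1 : (a * b = a' * b')%N.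
    by move/eqP: e; rewrite -!mulnA eqn_pmul2l // => /eqP.
  have : (a %| a' * b')%N by rewrite -e1 dvdn_mulr.
  rewrite Euclid_dvdM // !dvdn_prime2 // => /orP[/eqP aa|/eqP ab]; last first.
    by move: (Py _ Pa); rewrite ab leqNgt yb'.
  move/eqP: e1; rewrite aa eqn_pmul2l ?prime_gt0 // => /eqP ->.
  by [].
move=> n; rewrite mem_filter mem_index_iota; apply/idP/allpairsP.
  move=> /andP[/and5P[cn wf qQ /eqP cw /andP[/eqP cj /eqP ci]] /andP[n0 nN]].
  have [nE c0] := well_factoredE Py n0 wf.
  have /andP[hP yq] := wf; have [Pp pn minp] := min_pdiv_inP hP.
  have q1 : (1 < max_pdiv n)%N.
    apply: leq_ltn_trans yq; apply: leq_trans (Py _ Pp).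
    by apply: prime_gt0; move: pn; rewrite mem_primes => /andP[].
  have n1 : (1 < n)%N by apply: leq_trans q1 _; apply: dvdn_leq => //; apply: max_pdiv_dvd.
  have pq : prime (max_pdiv n) by apply: max_pdiv_prime.
  have dq : (max_pdiv n %| n)%N by apply: max_pdiv_dvd.
  have := pn; rewrite mem_primes => /and3P[pp _ dp].
  exists (min_pdiv_in P n, max_pdiv n); split; rewrite /= ?mem_filter ?mem_iota /=.
  - rewrite Pp pp cj eqxx (coprime_dvdl dp cn) /=; apply/andP; split; last first.
      by rewrite ltnS (leq_trans (dvdn_leq _ dp)).
    apply/allP => r; rewrite mem_primes => /and3P[pr _ dr]; apply/implyP => Pr.
    apply: minp => //; rewrite mem_primes pr n0 /= nE cw.
    by rewrite !dvdn_mulr.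
  - rewrite pq yq (coprime_dvdl dq cn) ci eqxx -{1}cw -cj qQ /=; apply/andP; split; last first.
      by rewrite ltnS (leq_trans (dvdn_leq _ dq)).
    apply/allP => r; rewrite mem_primes => /and3P[pr _ dr].
    apply: max_pdiv_max; rewrite inE mem_primes pr n0 /= nE cw.
    by rewrite !dvdn_mulr.
  - by rewrite {1}nE cw.
case=> [[p q]] /= [hp hq ->] {n}.
move: hp hq; rewrite !mem_filter.
move=> /andP[/and5P[Pp pp cp /eqP cj /allP hp] _].
move=> /andP[/and5P[pq yq cq qQ /andP[/eqP ci /allP hq]] _].
set n := (w * p * q)%N.
have n0 : (0 < n)%N by rewrite !muln_gt0 w0 !prime_gt0.
have primesn r : r \in primes n -> [\/ r \in primes w, r = p | r = q].
  rewrite mem_primes => /and3P[pr _]; rewrite /n !Euclid_dvdM // (dvdn_prime2 pr pp) (dvdn_prime2 pr pq).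
  case/orP => [/orP[dr|/eqP ->]|/eqP ->]; [|by constructor 2|by constructor 3].
  by constructor 1; rewrite mem_primes pr w0 dr.
have pn : p \in primes n by rewrite mem_primes pp n0 /n dvdn_mulr // dvdn_mull.
have qn : q \in primes n by rewrite mem_primes pq n0 /n dvdn_mull.
have ep : min_pdiv_in P n = p.
  apply: min_pdiv_in_eq => // r /primesn [rw|->//|->] Pr.
    by have /implyP := hp r rw; apply.
  by move: (Py _ Pr); rewrite leqNgt yq.
have eq : max_pdiv n = q.
  apply: max_pdiv_eq => // r /primesn [rw|->|->//]; first exact: hq.
  by apply: leq_trans (Py _ Pp) (ltnW yq).
have ew : outer_part P n = w.
  by rewrite /outer_part ep eq /n -mulnA mulnK // muln_gt0 !prime_gt0.
rewrite ep eq ew cj ci !eqxx qQ n0 ltnS HQ ?cj // !andbT /=.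
rewrite /n !coprimeMl cwm cp cq /= /well_factored -/n eq yq andbT.
by apply/hasP; exists p.
Qed.

Lemma partition_big_nat (V : nmodType) (r : seq nat) (P : pred nat) (h : nat -> nat)
    (M : nat) (F : nat -> V) : (forall n, n \in r -> P n -> (h n < M)%N) ->
  \sum_(n <- r | P n) F n = \sum_(0 <= w < M) \sum_(n <- r | P n && (h n == w)) F n.
Proof.
move=> H; rewrite big_mkord (exchange_big_dep P) /=; last by move=> w n _ /andP[].
rewrite big_seq_cond [RHS]big_seq_cond; apply: eq_bigr => n /andP[nr Pn].
by rewrite (big_pred1 (Ordinal (H n nr Pn))) // => w; rewrite Pn /= eq_sym.
Qed.

(** An [n] is determined by its triple of factors, so triples are counted; letting [w] and [p] run
    over all integers up to [N] produces two harmonic sums. *)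
Lemma leftover_count_le (R : realType) (P : pred nat) (y N : nat) (cl : nat -> nat)
    (Q : nat -> nat -> nat) (eps : R) : (0 < N)%N -> 0 <= eps ->
  (forall p, P p -> (p <= y)%N) ->
  (forall w p, (0 < w)%N -> (0 < p)%N -> P p ->
    (size [seq q <- iota 0 N.+1 |
       [&& Q w (cl p) < q, y < q & w * p * q <= N]%N])%:R <= eps * (N%:R / w%:R / p%:R)) ->
  (\sum_(1 <= n < N.+1 | well_factored P y n &&
      ~~ (max_pdiv n <= Q (outer_part P n) (cl (min_pdiv_in P n)))%N) 1)%N%:R <=
    eps * (N%:R * (1 + ln N%:R) ^+ 2).
Proof.
move=> N0 eps0 Py H.
pose T w p := [seq q <- iota 0 N.+1 | [&& Q w (cl p) < q, y < q & w * p * q <= N]%N].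
pose t n := (outer_part P n, (min_pdiv_in P n, max_pdiv n)).
pose TT := [seq (w, pq) | w <- iota 1 N, pq <- [seq (p, q) | p <- [seq p <- iota 1 N | P p], q <- T w p]].
set S := (\sum_(1 <= n < N.+1 | _) 1)%N.
have -> : S = size (map t [seq n <- index_iota 1 N.+1 | well_factored P y n &&
    ~~ (max_pdiv n <= Q (outer_part P n) (cl (min_pdiv_in P n)))%N]).
  by rewrite size_map /S size_filter sum1_count.
have sub : (size (map t [seq n <- index_iota 1 N.+1 | well_factored P y n &&
    ~~ (max_pdiv n <= Q (outer_part P n) (cl (min_pdiv_in P n)))%N]) <= size TT)%N.
  apply: uniq_leq_size.
    rewrite map_inj_in_uniq ?filter_uniq ?iota_uniq // => n n'.
    rewrite !mem_filter !mem_index_iota => /andP[/andP[wf _] /andP[n0 _]].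
    move=> /andP[/andP[wf' _] /andP[n0' _]].
    have [e _] := well_factoredE Py n0 wf; have [e' _] := well_factoredE Py n0' wf'.
    by rewrite /t => -[h1 h2 h3]; rewrite e e' h1 h2 h3.
  move=> x /mapP[n]; rewrite mem_filter mem_index_iota.
  move=> /andP[/andP[wf nQ] /andP[n0 nN]] -> {x}.
  have [e c0] := well_factoredE Py n0 wf.
  have /andP[hP yq] := wf; have [Pp pn _] := min_pdiv_inP hP.
  have p0 : (0 < min_pdiv_in P n)%N by move: pn; rewrite mem_primes => /andP[/prime_gt0].
  have q0 : (0 < max_pdiv n)%N by apply: leq_ltn_trans yq.
  apply/allpairsPdep; exists (outer_part P n), (min_pdiv_in P n, max_pdiv n); split=> //.
    rewrite mem_iota c0 add1n (leq_ltn_trans _ nN) // {2}e -mulnA leq_pmulr //.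
    by rewrite muln_gt0 p0.
  apply/allpairsPdep; exists (min_pdiv_in P n), (max_pdiv n); split=> //.
    rewrite mem_filter Pp mem_iota p0 add1n (leq_ltn_trans _ nN) //.
    by rewrite {2}e mulnAC leq_pmull // muln_gt0 c0.
  rewrite mem_filter ltnNge nQ yq -e mem_iota /= -ltnS nN add0n (leq_ltn_trans _ nN) //.
  by rewrite {2}e leq_pmull // muln_gt0 c0.
apply: (@le_trans _ _ (size TT)%:R); first by rewrite ler_nat.
rewrite -sum1_size big_allpairs_dep natr_sum.
apply: (@le_trans _ _ (\sum_(1 <= w < N.+1) \sum_(1 <= p < N.+1) eps * (N%:R / w%:R / p%:R))).
  rewrite /index_iota subSS subn0 big_seq [leRHS]big_seq; apply: ler_sum => w.
  rewrite mem_iota => /andP[w0 _].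
  rewrite big_allpairs_dep big_filter natr_sum [leRHS](bigID P) /=.
  rewrite -[leLHS]addr0; apply: lerD; last first.
    by apply: sumr_ge0 => p _; rewrite mulr_ge0 // !divr_ge0.
  rewrite big_seq_cond [leRHS]big_seq_cond; apply: ler_sum => p /andP[].
  rewrite mem_iota => /andP[p0 _] Pp.
  by rewrite sum1_size; apply: H.
have -> : \sum_(1 <= w < N.+1) \sum_(1 <= p < N.+1) eps * (N%:R / w%:R / p%:R) =
   eps * (N%:R * (\sum_(1 <= w < N.+1) w%:R^-1) ^+ 2) :> R.
  rewrite expr2 big_distrlr /= !mulr_sumr; apply: eq_bigr => w _.
  by rewrite !mulr_sumr; apply: eq_bigr => p _; ring.
rewrite ler_wpM2l // ler_wpM2l // lerXn2r ?nnegrE ?harmonic_le //.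
  by apply: sumr_ge0 => w _; rewrite invr_ge0.
by rewrite addr_ge0 // ln_nat_ge0.
Qed.

Lemma normc_count_le (R : realType) (r : seq nat) (P P' : pred nat) (F : nat -> R[i]) :
  (forall n, normc (F n) <= 1) -> (forall n, n \in r -> P n -> P' n) ->
  normc (\sum_(n <- r | P n) F n) <= (\sum_(n <- r | P' n) 1)%N%:R.
Proof.
move=> F1 PP'; apply: le_trans (normc_sum _ _ _) _.
rewrite natr_sum big_mkcond [leRHS]big_mkcond big_seq [leRHS]big_seq.
apply: ler_sum => n nr; case: ifP => [/(PP' n nr) ->//|_].
by case: ifP.
Qed.

Lemma ec_modinvM (R : realType) (m : nat) (a : int) (w p q : nat) : (0 < m)%N ->
  (0 < w)%N -> (0 < p)%N -> (0 < q)%N -> coprime w m -> coprime p m -> coprime q m ->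
  ec R m (a * (modinv m (w * p * q))%:Z) =
  ec R m (`|((a * (modinv m w)%:Z) %% m)%Z| * modinv m p * modinv m q)%N.
Proof.
move=> m0 w0 p0 q0 cw cp cq; apply: ec_mod => //.
have m0' : m%:Z != 0 by rewrite eqz_nat -lt0n.
rewrite !PoszM gez0_abs ?modz_ge0 // -mulrA modzMml -!mulrA.
rewrite -modzMmr -[in RHS]modzMmr -!PoszM !modz_nat; congr ((_ * Posz _) %% _)%Z.
rewrite -(@modinvM m (w * p) q) ?muln_gt0 ?w0 ?coprimeMl ?cw //.
by rewrite -modnMml -(@modinvM m w p) // modnMml mulnA.
Qed.

Lemma coprime_twist (m : nat) (a : int) (w : nat) : (1 < m)%N -> (0 < w)%N ->
  coprimez a m -> coprime w m -> coprime `|((a * (modinv m w)%:Z) %% m)%Z| m.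
Proof.
move=> m1 w0 ca cw.
have : coprimez (a * (modinv m w)%:Z) m.
  by rewrite coprimezMl ca /=; apply: coprime_modinv.
rewrite /coprimez -gcdz_modl => h; apply/eqP.
by move/eqP: h; rewrite /gcdz /= => -[].
Qed.

(** The reduction to bilinear sums, with [P], the cells [cl] and the thresholds [Q] left abstract.
    The four terms come from [n] without prime in [P], smooth [n], [n] whose [q] exceeds its
    threshold, and the rectangles. *)
Lemma kloosterman_core (R : realType) (m N y J : nat) (a : int) (P : pred nat)
    (cl : nat -> nat) (Q : nat -> nat -> nat) (eps tau : R) :
  (1 < m)%N -> (0 < N)%N -> 0 <= eps -> 0 <= tau -> coprimez a m ->
  (forall p, P p -> (p <= y)%N) ->
  (forall w p q, (0 < w)%N -> (q <= Q w (cl p))%N -> (w * p * q <= N)%N) ->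
  (forall p, P p -> (cl p < J)%N) ->
  (forall w p, (0 < w)%N -> (0 < p)%N -> P p ->
    (size [seq q <- iota 0 N.+1 |
       [&& Q w (cl p) < q, y < q & w * p * q <= N]%N])%:R <= eps * (N%:R / w%:R / p%:R)) ->
  (forall (b : nat) (A B : seq nat) (X Y : nat), coprime b m -> uniq A -> uniq B ->
     X \in A -> (0 < Y)%N ->
     (forall p, p \in A -> [/\ P p, prime p, coprime p m & cl p = cl X]) ->
     (forall q, q \in B -> [/\ prime q, (y < q <= N)%N, (Y <= q <= 2 * Y)%N & coprime q m]) ->
     normc (\sum_(p <- A) \sum_(q <- B) ec R m (b * modinv m p * modinv m q)%N) <=
       tau * (X%:R * Y%:R)) ->
  normc (kloosterman_sum R m N a) <=
    (\sum_(1 <= n < N.+1 | ~~ has P (primes n)) 1)%N%:R +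
    (\sum_(1 <= n < N.+1 | smooth y n) 1)%N%:R +
    eps * (N%:R * (1 + ln N%:R) ^+ 2) +
    tau * (N%:R * (1 + ln N%:R)) * J%:R * (trunc_log 2 N).+1%:R.
Proof.
move=> m1 N0 eps0 tau0 ca Py HQ HJ Hleft Hbil.
have m0 : (0 < m)%N by apply: ltnW.
pose F n := ec R m (a * (modinv m n)%:Z).
have F1 n : normc (F n) <= 1 by rewrite normc_ec.
pose mn n := (max_pdiv n <= Q (outer_part P n) (cl (min_pdiv_in P n)))%N.
have -> : kloosterman_sum R m N a =
   \sum_(1 <= n < N.+1 | [&& coprime n m, well_factored P y n & mn n]) F n +
   \sum_(1 <= n < N.+1 | [&& coprime n m, well_factored P y n & ~~ mn n]) F n +
   \sum_(1 <= n < N.+1 | coprime n m && ~~ well_factored P y n) F n.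
  rewrite /kloosterman_sum (bigID (well_factored P y)) /=; congr (_ + _).
  by rewrite (bigID mn) /=; congr (_ + _); apply: eq_bigl => n; rewrite andbA.
set Sm := \sum_(_ <= _ < _ | [&& _, _ & mn _]) _; set Sl := \sum_(_ <= _ < _ | [&& _, _ & _]) _.
set Sb := \sum_(_ <= _ < _ | _) _.
have HSl : normc Sl <= eps * (N%:R * (1 + ln N%:R) ^+ 2).
  apply: le_trans (leftover_count_le N0 eps0 Py Hleft).
  by apply: normc_count_le => // n _ /and3P[_ -> ->].
have HSb : normc Sb <= (\sum_(1 <= n < N.+1 | ~~ has P (primes n)) 1)%N%:R +
    (\sum_(1 <= n < N.+1 | smooth y n) 1)%N%:R.
  rewrite -natrD.
  apply: (@le_trans _ _ (\sum_(1 <= n < N.+1 | ~~ has P (primes n) || smooth y n) 1)%N%:R).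
    apply: normc_count_le => // n; rewrite mem_index_iota => /andP[n0 _] /andP[_].
    rewrite /well_factored negb_and => /orP[->//|]; rewrite -leqNgt => qy.
    apply/orP; right; apply/allP => r rn; apply: leq_trans qy.
    exact: max_pdiv_max.
  rewrite ler_nat !(big_mkcond (fun n => _ || _)) (big_mkcond (smooth y)).
  rewrite [X in (_ <= X + _)%N]big_mkcond -big_split /=; apply: leq_sum => n _.
  by case: (has _ _); case: (smooth _ _).
have HSm : normc Sm <= tau * (N%:R * (1 + ln N%:R)) * J%:R * (trunc_log 2 N).+1%:R.
  have -> : Sm = \sum_(0 <= w < N.+1) \sum_(0 <= j < J) \sum_(0 <= i < (trunc_log 2 N).+1)
      \sum_(1 <= n < N.+1 | [&& coprime n m, well_factored P y n, mn n, outer_part P n == w,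
        cl (min_pdiv_in P n) == j & trunc_log 2 (max_pdiv n) == i]) F n.
    rewrite /Sm (@partition_big_nat _ _ _ (outer_part P) N.+1); last first.
      move=> n; rewrite mem_index_iota => /andP[n0 nN] _.
      by apply: leq_ltn_trans nN; apply: leq_div.
    apply: eq_bigr => w _; rewrite (@partition_big_nat _ _ _ (fun n => cl (min_pdiv_in P n)) J); last first.
      move=> n _ /andP[/and3P[_ /andP[/min_pdiv_inP[Pp _ _] _] _] _]; exact: HJ.
    apply: eq_bigr => j _; rewrite (@partition_big_nat _ _ _ (fun n => trunc_log 2 (max_pdiv n)) (trunc_log 2 N).+1); last first.
      move=> n; rewrite mem_index_iota => /andP[n0 nN] _.
      rewrite ltnS; apply: leq_trunc_log; apply: leq_trans (_ : n <= N)%N => //.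
      by apply: dvdn_leq => //; apply: max_pdiv_dvd.
    apply: eq_bigr => i _; apply: eq_bigl => n; rewrite -!andbA.
    by rewrite /mn.
  apply: (@le_trans _ _ (\sum_(1 <= w < N.+1) \sum_(0 <= j < J)
      \sum_(0 <= i < (trunc_log 2 N).+1) tau * (N%:R / w%:R))).
    rewrite big_ltn //.
    (* The term [w = 0] is empty, since an outer part is positive. *)
    set Z := (X in normc (X + _)); have -> : Z = 0.
      rewrite /Z; apply: big1_seq => j _; apply: big1_seq => i _; apply: big1_seq => n /andP[].
      rewrite mem_index_iota => /and5P[_ wf _ /eqP e _] /andP[n0 _].
      by have [_] := well_factoredE Py n0 wf; rewrite e.
    rewrite add0r; apply: le_trans (normc_sum _ _ _) _.
    rewrite big_nat [leRHS]big_nat; apply: ler_sum => w /andP[w0 wN].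
    apply: le_trans (normc_sum _ _ _) _; apply: ler_sum => j _.
    apply: le_trans (normc_sum _ _ _) _; apply: ler_sum => i _.
    have b0 : 0 <= tau * (N%:R / w%:R) by rewrite mulr_ge0 // divr_ge0.
    have [cw|ncw] := boolP (coprime w m); last first.
      rewrite big1_seq ?ComplexField.Normc.normc0 // => n /andP[].
      move=> /and5P[cn wf _ /eqP e _]; rewrite mem_index_iota => /andP[n0 _].
      have [nE _] := well_factoredE Py n0 wf.
      move: ncw; rewrite -e => /negP[]; apply: coprime_dvdl cn.
      by rewrite {2}nE -mulnA dvdn_mulr.
    rewrite /mn (@block_sum _ F P y N m cl Q w j i Py w0 cw HQ).
    set A := small_part _ _ _ _ _ _; set B := large_part _ _ _ _ _ _.
    have HA p : p \in A -> [/\ P p, prime p, coprime p m & cl p = j].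
      by rewrite mem_filter => /andP[/and5P[-> -> -> /eqP -> _] _].
    have HB q : q \in B -> [/\ prime q, (y < q <= N)%N, (2 ^ i <= q <= 2 * 2 ^ i)%N,
         coprime q m & (q <= Q w j)%N].
      rewrite mem_filter mem_iota => /andP[/and5P[pq -> -> -> /andP[/eqP <- _]] /andP[_ ]].
      rewrite add0n ltnS => ->; have := trunc_log_bounds (isT : 1 < 2)%N (prime_gt0 pq).
      by rewrite /= expnS => /andP[-> /ltnW ->].
    case EA : A => [|X A']; first by rewrite big_nil ComplexField.Normc.normc0.
    case EB : B => [|q B'].
      by under eq_bigr do rewrite big_nil; rewrite big1 // ComplexField.Normc.normc0.
    have XA : X \in A by rewrite EA mem_head.
    have qB : q \in B by rewrite EB mem_head.
    rewrite -EA -EB.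
    have [PX pX cX clX] := HA _ XA.
    have -> : \sum_(p <- A) \sum_(q <- B) F (w * p * q)%N = \sum_(p <- A) \sum_(q <- B)
        ec R m (`|((a * (modinv m w)%:Z) %% m)%Z| * modinv m p * modinv m q)%N.
      rewrite big_seq [RHS]big_seq; apply: eq_bigr => p /HA[_ pp cp _].
      rewrite big_seq [RHS]big_seq; apply: eq_bigr => q' /HB[pq _ _ cq _].
      by apply: ec_modinvM => //; apply: prime_gt0.
    (* Any [q] in the rectangle has [q >= 2 ^ i] and [w * X * q <= N], so the bound for it is at
       most [tau * (N / w)]. *)
    apply: (@le_trans _ _ (tau * (X%:R * (2 ^ i)%N%:R))).
      apply: Hbil; rewrite ?filter_uniq ?iota_uniq ?expn_gt0 //.
      - exact: coprime_twist.
      - by move=> p /HA[? ? ? ->].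
      - by move=> q' /HB[].
    rewrite ler_wpM2l // ler_pdivlMr ?ltr0n // -!natrM ler_nat.
    have [_ _ /andP[q1 _] _ qQ] := HB _ qB.
    have := HQ w X q w0; rewrite clX => /(_ qQ); apply: leq_trans.
    by rewrite mulnC mulnA leq_mul2l q1 orbT.
  have -> : \sum_(1 <= w < N.+1) \sum_(0 <= j < J)
      \sum_(0 <= i < (trunc_log 2 N).+1) tau * (N%:R / w%:R) =
      tau * (N%:R * \sum_(1 <= w < N.+1) w%:R^-1) * J%:R * (trunc_log 2 N).+1%:R.
    rewrite !mulr_sumr !mulr_suml; apply: eq_bigr => w _.
    rewrite !sumr_const_nat !subn0 -[LHS]mulr_natr -[X in X * _ = _]mulr_natr; ring.
  rewrite !ler_wpM2r ?ler0n // ler_wpM2l // ler_wpM2l ?ler0n //.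
  exact: harmonic_le.
apply: le_trans (ler_normcD _ _) _; apply: le_trans (lerD (ler_normcD _ _) HSb) _.
by move: HSl HSm; lra.
Qed.

(** * Bilinear sums over primes *)

Lemma uniq_size_le (A : seq nat) (x : nat) : uniq A ->
  (forall p, p \in A -> (0 < p <= x)%N) -> (size A <= x)%N.
Proof.
move=> uA HA; rewrite -(size_iota 1 x); apply: uniq_leq_size => // p /HA.
by rewrite mem_iota add1n ltnS.
Qed.

Lemma modn_cancel (m b s t : nat) : (1 < m)%N -> coprime b m ->
  (b * s = b * t %[mod m])%N -> (s = t %[mod m])%N.
Proof.
move=> m1 cb e; have b0 : (0 < b)%N.
  by case: b cb {e} => //; rewrite /coprime gcd0n => /eqP e; rewrite e in m1.
have h x : (x = modinv m b * (b * x) %[mod m])%N.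
  by rewrite mulnA (mulnC _ b) -modnMml modinvP // modnMml mul1n.
by rewrite (h s) (h t) -modnMmr e modnMmr.
Qed.

(** The unit [b] is moved into the weights of the [q], where it creates no new coincidence modulo
    [m]. *)
Lemma bilinear_primes_pow_le (R : realType) (m b k l X Y : nat) (A B : seq nat) :
  (1 < m)%N -> coprime b m -> uniq A -> uniq B -> (0 < X)%N -> (0 < Y)%N ->
  (forall p, p \in A -> [/\ prime p, (k.+1 < p)%N, (X <= p <= 2 * X)%N & coprime p m]) ->
  (forall q, q \in B -> [/\ prime q, (l.+1 < q)%N, (Y <= q <= 2 * Y)%N & coprime q m]) ->
  normc (\sum_(p <- A) \sum_(q <- B) ec R m (b * modinv m p * modinv m q)%N)
     ^+ (2 * k.+1 * l.+1) <=
  m%:R * (((k.+1 * (2 * X) ^ (2 * k.+1)) %/ (m * X)).+1 * k.+1 ^ k.+1)%N%:R *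
   (((l.+1 * (2 * Y) ^ (2 * l.+1)) %/ (m * Y)).+1 * l.+1 ^ l.+1)%N%:R *
   (2 * X)%N%:R ^+ (k.+1 * (2 * l).+1) * (2 * Y)%N%:R ^+ (l.+1 * (2 * k).+1).
Proof.
move=> m1 cb uA uB X0 Y0 HA HB; have m0 : (0 < m)%N by apply: ltnW.
have memA (i : 'I_(size A)) : nth 0%N A i \in A by apply: mem_nth.
have memB (i : 'I_(size B)) : nth 0%N B i \in B by apply: mem_nth.
pose u (i : 'I_(size A)) := modinv m (nth 0%N A i).
pose v (j : 'I_(size B)) := (b * modinv m (nth 0%N B j))%N.
have -> : \sum_(p <- A) \sum_(q <- B) ec R m (b * modinv m p * modinv m q)%N =
    \sum_(i < size A) \sum_(j < size B) ec R m (u i * v j)%N.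
  rewrite (big_nth 0%N) big_mkord; apply: eq_bigr => i _.
  rewrite (big_nth 0%N) big_mkord; apply: eq_bigr => j _.
  by rewrite /u /v mulnCA mulnA.
set ra := (_ * k.+1 ^ k.+1)%N; set rb := (_ * l.+1 ^ l.+1)%N.
have inj (s : seq nat) : uniq s -> injective (fun i : 'I_(size s) => nth 0%N s i).
  by move=> us i j /eqP; rewrite nth_uniq // => /eqP/val_inj.
have H1 (f : {ffun 'I_k.+1 -> 'I_(size A)}) : (#|[set g : {ffun 'I_k.+1 -> 'I_(size A)} |
      (\sum_i u (g i))%N == (\sum_i u (f i))%N %[mod m]]| <= ra)%N.
  apply: (@fibre_sum_inv_le _ (fun i : 'I_(size A) => nth 0%N A i) u k.+1 m (2 * X) X f) => //.
  - exact: inj.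
  - by move=> i; case: (HA _ (memA i)).
  - by move=> i; case: (HA _ (memA i)).
  - by move=> i; case: (HA _ (memA i)).
  - move=> i; have [pp _ _ cp] := HA _ (memA i).
    by rewrite modinvP // prime_gt0.
have H2 (f : {ffun 'I_l.+1 -> 'I_(size B)}) : (#|[set g : {ffun 'I_l.+1 -> 'I_(size B)} |
      (\sum_i v (g i))%N == (\sum_i v (f i))%N %[mod m]]| <= rb)%N.
  pose v' (j : 'I_(size B)) := modinv m (nth 0%N B j).
  apply: (@leq_trans #|[set g : {ffun 'I_l.+1 -> 'I_(size B)} |
      (\sum_i v' (g i))%N == (\sum_i v' (f i))%N %[mod m]]|).
    apply/subset_leq_card/fintype.subsetP => g; rewrite !inE /v -!big_distrr /=.
    by move=> /eqP/(modn_cancel m1 cb)/eqP.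
  apply: (@fibre_sum_inv_le _ (fun i : 'I_(size B) => nth 0%N B i) v' l.+1 m (2 * Y) Y f) => //.
  - exact: inj.
  - by move=> i; case: (HB _ (memB i)).
  - by move=> i; case: (HB _ (memB i)).
  - by move=> i; case: (HB _ (memB i)).
  - move=> i; have [pp _ _ cp] := HB _ (memB i).
    by rewrite modinvP // prime_gt0.
apply: le_trans (bilinear_le R m0 H1 H2) _; rewrite !card_ord.
have sA : (size A <= 2 * X)%N.
  by apply: uniq_size_le => // p /HA[pp _ /andP[_ ->] _]; rewrite prime_gt0.
have sB : (size B <= 2 * Y)%N.
  by apply: uniq_size_le => // p /HB[pp _ /andP[_ ->] _]; rewrite prime_gt0.
apply: ler_pM; rewrite ?mulr_ge0 ?exprn_ge0 ?ler0n //.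
  by apply: ler_pM; rewrite ?mulr_ge0 ?exprn_ge0 ?ler0n // lerXn2r ?nnegrE ?ler_nat ?ler0n.
by rewrite lerXn2r ?nnegrE ?ler_nat ?ler0n.
Qed.

(** [k ^ k] counts the tuples over the same primes, and [2 ^+ k] comes from primes reaching up to
    [2 * X]; the constant 2 is due to [1 + k * 2 ^ k <= 4 ^ k] and [4 <= expR 2]. *)
Lemma tuple_loss_le (R : realType) (k : nat) : (0 < k)%N ->
  (k ^ k)%N%:R * (1 + k%:R * 2 ^+ k) <= expR (k%:R * (ln k%:R + 2)) :> R.
Proof.
move=> k0; have kR : (0 : R) < k%:R by rewrite ltr0n.
rewrite [k%:R * (ln _ + 2)]mulrDr expRD natrX expRM_natl lnK ?posrE //.
rewrite ler_wpM2l ?exprn_ge0 ?(ltW kR) // expRM_natl.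
have e2 : (4 : R) <= expR 2.
  have -> : (2 : R) = 1 + 1 by []. 
  by rewrite expRD; have := expR_ge1Dx (1 : R); nra.
apply: (@le_trans _ _ (4 ^+ k)); last by rewrite lerXn2r ?nnegrE ?expR_ge0 //; lra.
rewrite -natrX -natrM -[1]/(1%:R) -natrD -natrX ler_nat.
have -> : (4 ^ k = 2 ^ k * 2 ^ k)%N by rewrite -expnMn.
have : (k < 2 ^ k)%N by apply: ltn_expl.
have : (1 < 2 ^ k)%N by rewrite -{1}(expn0 2) ltn_exp2l.
by nia.
Qed.

(** Each of the two variables pays for [m ^ (1/2)]. The hypotheses place [m] between
    [X ^ (2 k - 2 + 2 d)] and [X ^ (2 k - 2 d)]: the upper end handles the 1 in the fibre bound, the
    lower end its quotient, and both yield [X ^ (- d)]. *)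
Lemma fibre_factor_le (R : realType) (m k X : nat) (d : R) : (0 < m)%N -> (0 < X)%N -> (0 < k)%N ->
  ln m%:R <= (2 * k%:R - 2 * d) * ln X%:R ->
  (2 * k%:R - 2 + 2 * d) * ln X%:R <= ln m%:R ->
  expR (ln m%:R / 2) * (((k * (2 * X) ^ (2 * k)) %/ (m * X)).+1 * k ^ k)%N%:R
     <= (2 * X)%N%:R ^+ k * (expR (k%:R * (ln k%:R + 2)) * expR (- (d * ln X%:R))).
Proof.
move=> m0 X0 k0; have mR : (0 : R) < m%:R by rewrite ltr0n.
have XR : (0 : R) < X%:R by rewrite ltr0n.
set L := ln m%:R; set x := ln X%:R => h1 h2.
have eL : m%:R = expR (L / 2) * expR (L / 2) :> R by rewrite -expRD -splitr lnK.
have eX : X%:R = expR x :> R by rewrite lnK.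
have eD : expR (- (d * x)) > 0 by apply: expR_gt0.
set q := ((k * _) %/ _)%N.
have hq : q%:R <= k%:R * (2 * X)%N%:R ^+ (2 * k) / (m%:R * X%:R) :> R.
  rewrite ler_pdivlMr ?mulr_gt0 // -natrX -!natrM ler_nat; exact: leq_trunc_div.
have X2 : (0 : R) < (2 * X)%N%:R ^+ k by rewrite exprn_gt0 // ltr0n muln_gt0.
rewrite natrM -[q.+1%:R]natr1.
apply: (@le_trans _ _ (expR (L / 2) *
    ((k%:R * (2 * X)%N%:R ^+ (2 * k) / (m%:R * X%:R) + 1) * (k ^ k)%N%:R))).
  by rewrite ler_wpM2l ?expR_ge0 // ler_wpM2r ?ler0n // lerD2r.
apply: (@le_trans _ _ ((2 * X)%N%:R ^+ k * ((k ^ k)%N%:R * (1 + k%:R * 2 ^+ k) * expR (- (d * x))))); last first.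
  rewrite ler_wpM2l ?(ltW X2) // ler_wpM2r ?expR_ge0 //; exact: tuple_loss_le.
have H1 : expR (L / 2) <= (2 * X)%N%:R ^+ k * expR (- (d * x)).
  apply: (@le_trans _ _ (X%:R ^+ k * expR (- (d * x)))).
    by rewrite eX -expRM_natl -expRD ler_expR; move: h1; lra.
  by rewrite ler_wpM2r ?expR_ge0 // lerXn2r ?nnegrE ?ler0n // ler_nat; lia.
have H2 : X%:R ^+ k <= expR (- (d * x)) * (expR (L / 2) * X%:R).
  by rewrite eX -expRM_natl -!expRD ler_expR; move: h2; lra.
have E : expR (L / 2) * ((k%:R * (2 * X)%N%:R ^+ (2 * k) / (m%:R * X%:R) + 1) * (k ^ k)%N%:R)
   = (k ^ k)%N%:R * (expR (L / 2) + (2 * X)%N%:R ^+ k * (k%:R * 2 ^+ k) * (X%:R ^+ k / (expR (L / 2) * X%:R))).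
  rewrite eL [(2 * k)%N]mul2n -[k.*2]addnn exprD natrM exprMn.
  set t := 2 ^+ k; set v := X%:R ^+ k; set e := expR _; set K := (k ^ k)%N%:R.
  by field; rewrite !gt_eqF ?expR_gt0.
rewrite E.
have -> : (2 * X)%N%:R ^+ k * ((k ^ k)%N%:R * (1 + k%:R * 2 ^+ k) * expR (- (d * x))) =
  (k ^ k)%N%:R * ((2 * X)%N%:R ^+ k * expR (- (d * x)) + (2 * X)%N%:R ^+ k * (k%:R * 2 ^+ k) * expR (- (d * x))) by ring.
rewrite ler_wpM2l ?ler0n //; apply: lerD => //.
rewrite ler_wpM2l ?mulr_ge0 ?exprn_ge0 ?ler0n //.
by rewrite ler_pdivrMr ?mulr_gt0 ?expR_gt0.
Qed.

(** [s] is the net saving: at the power [2 * k * l] the tuple losses and [expR (2 k l s)] together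
    must fit into [X ^ d]. The 4 comes from the ranges up to [2 * X] and [2 * Y]. *)
Lemma bilinear_primes_le (R : realType) (m b k l X Y : nat) (A B : seq nat) (d s : R) :
  (1 < m)%N -> coprime b m -> uniq A -> uniq B -> (0 < X)%N -> (0 < Y)%N ->
  (0 < k)%N -> (0 < l)%N ->
  (forall p, p \in A -> [/\ prime p, (k < p)%N, (X <= p <= 2 * X)%N & coprime p m]) ->
  (forall q, q \in B -> [/\ prime q, (l < q)%N, (Y <= q <= 2 * Y)%N & coprime q m]) ->
  ln m%:R <= (2 * k%:R - 2 * d) * ln X%:R ->
  (2 * k%:R - 2 + 2 * d) * ln X%:R <= ln m%:R ->
  ln m%:R <= 2 * l%:R * ln Y%:R :> R ->
  (2 * l%:R - 2) * ln Y%:R <= ln m%:R :> R ->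
  k%:R * (ln k%:R + 2) + l%:R * (ln l%:R + 2) + 2 * k%:R * l%:R * s <= d * ln X%:R ->
  normc (\sum_(p <- A) \sum_(q <- B) ec R m (b * modinv m p * modinv m q)%N) <=
    4 * expR (- s) * (X%:R * Y%:R).
Proof.
case: k l => [//|k] [//|l] m1 cb uA uB X0 Y0 k0 l0 HA HB hX1 hX2 hY1 hY2 hs.
have m0 : (0 < m)%N by apply: ltnW.
have mR : (0 : R) < m%:R by rewrite ltr0n.
have XR : (0 : R) < X%:R by rewrite ltr0n.
have YR : (0 : R) < Y%:R by rewrite ltr0n.
have := bilinear_primes_pow_le R m1 cb uA uB X0 Y0 HA HB.
have := @fibre_factor_le R m k.+1 X d m0 X0 k0 hX1 hX2.
(* The margin for [q] is 0: this variable contributes its tuple loss and no saving. *)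
have := @fibre_factor_le R m l.+1 Y 0 m0 Y0 l0.
rewrite !mulr0 subr0 addr0 mul0r oppr0 expR0 mulr1 => /(_ hY1 hY2).
set ra := (_ * k.+1 ^ k.+1)%N%:R; set rb := (_ * l.+1 ^ l.+1)%N%:R.
set S := normc _; set x := (2 * X)%N%:R; set y := (2 * Y)%N%:R.
set ek := expR (k.+1%:R * _); set el := expR (l.+1%:R * _); set ed := expR (- _).
set M := expR (ln m%:R / 2) => HB' HA' HS.
have eM : m%:R = M * M :> R by rewrite -expRD -splitr lnK.
have x0 : 0 <= x :> R by rewrite ler0n.
have y0 : 0 <= y :> R by rewrite ler0n.
have -> : 4 * expR (- s) * (X%:R * Y%:R) = x * y * expR (- s) :> R.
  by rewrite /x /y !natrM; ring.
rewrite -(@ler_pXn2r _ (2 * k.+1 * l.+1)) ?nnegrE ?muln_gt0 // ?normc_ge0 //; last first.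
  by rewrite !mulr_ge0 ?expR_ge0.
apply: le_trans HS _.
have -> : m%:R * ra * rb * x ^+ (k.+1 * (2 * l).+1) * y ^+ (l.+1 * (2 * k).+1) =
  (M * ra) * (M * rb) * (x ^+ (k.+1 * (2 * l).+1) * y ^+ (l.+1 * (2 * k).+1)).
  by rewrite eM; ring.
apply: (@le_trans _ _ ((x ^+ k.+1 * (ek * ed)) * (y ^+ l.+1 * el) *
    (x ^+ (k.+1 * (2 * l).+1) * y ^+ (l.+1 * (2 * k).+1)))).
  rewrite ler_wpM2r ?mulr_ge0 ?exprn_ge0 //.
  by apply: ler_pM => //; rewrite mulr_ge0 ?expR_ge0 ?ler0n.
have ex u v : (2 * u.+1 * v.+1 = u.+1 + u.+1 * (2 * v).+1)%N.
  have e : ((2 * v).+2 = 2 * v.+1)%N by rewrite mulnS.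
  by rewrite -mulnS e mulnCA mulnA.
have -> : (x * y * expR (- s)) ^+ (2 * k.+1 * l.+1) =
   expR (- (2 * k.+1%:R * l.+1%:R * s)) * (x ^+ (k.+1 + k.+1 * (2 * l).+1) * y ^+ (l.+1 + l.+1 * (2 * k).+1)).
  rewrite !exprMn -expRM_natr mulrC; congr (expR _ * (_ ^+ _ * _ ^+ _)).
  - by rewrite !natrM; ring.
  - exact: ex.
  - by rewrite mulnAC ex.
rewrite !exprD.
have -> : x ^+ k.+1 * (ek * ed) * (y ^+ l.+1 * el) *
   (x ^+ (k.+1 * (2 * l).+1) * y ^+ (l.+1 * (2 * k).+1)) =
  (ek * el * ed) * (x ^+ k.+1 * x ^+ (k.+1 * (2 * l).+1) *
    (y ^+ l.+1 * y ^+ (l.+1 * (2 * k).+1))) by ring.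
rewrite ler_wpM2r ?mulr_ge0 ?exprn_ge0 //.
by rewrite /ek /el /ed -!expRD ler_expR; move: hs; lra.
Qed.

(** * The sieving primes *)

(* [log_index L p] is the [k] with [p ^ (2 k - 2) <= m < p ^ (2 k)] when [L = ln m];
   [good_prime] keeps [p] away from the two ends of this range, where the bilinear
   estimate saves nothing. *)
Definition log_index (R : realType) (L : R) (p : nat) : nat :=
  (Num.trunc (L / (2 * ln p%:R))).+1.

Definition good_prime (R : realType) (L d : R) (K2 K1 : nat) (p : nat) : bool :=
  let k := log_index L p in
  [&& prime p, (K2 < k <= K1)%N, (k%:R - 1 + d) * (2 * ln p%:R) <= L &
    L <= (k%:R - d) * (2 * ln p%:R)].

(** Good primes of index [k] fill the range of [ln p] from [la = L / (2 (k - d))] to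
    [lb = L / (2 (k - 1 + d))]. Mertens' estimate there, with [ln p <= lb], gives
    [(lb - la - 6) / lb], which is [(1 - 2 d) / (k - d)] up to [12 k / L]; the sum over [k] is
    harmonic. *)
Lemma sum_good_prime_ge (R : realType) (L d : R) (K2 K1 M : nat) :
  0 < L -> 0 < d -> d < 2^-1 -> (0 < K2)%N -> (K2 <= K1)%N ->
  expR (L / (2 * K2%:R)) < M%:R ->
  (1 - 2 * d) * (ln K1.+1%:R - ln K2.+1%:R) - 12 * K1%:R ^+ 2 / L <=
    \sum_(0 <= p < M | good_prime L d K2 K1 p) p%:R^-1.
Proof.
move=> L0 d0 d2 K20 K21 hM.
rewrite (@partition_big_nat _ _ _ (log_index L) K1.+1); last first.
  by move=> p _ /and4P[_ /andP[_ h] _ _].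
rewrite (@big_cat_nat _ _ _ K2.+1) //=.
have pos1 : 0 <= \sum_(0 <= k < K2.+1) \sum_(0 <= p < M | good_prime L d K2 K1 p && (log_index L p == k)) p%:R^-1 :> R.
  by apply: sumr_ge0 => k _; apply: sumr_ge0 => p _; rewrite invr_ge0.
rewrite -[leLHS]add0r; apply: lerD => //.
have step (k : nat) : (K2 < k)%N -> (k <= K1)%N ->
    (1 - 2 * d) * k%:R^-1 - 12 * k%:R / L <=
    \sum_(0 <= p < M | good_prime L d K2 K1 p && (log_index L p == k)) p%:R^-1.
  move=> hk1 hk2.
  have k2 : (2 : R) <= k%:R by rewrite (ler_nat _ 2); apply: leq_trans hk1.
  pose la := L / (2 * (k%:R - d)); pose lb := L / (2 * (k%:R - 1 + d)).
  have kd : 0 < k%:R - d by lra.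
  have kd1 : 0 < k%:R - 1 + d by lra.
  have la0 : 0 <= la by rewrite divr_ge0 // ?ltW // mulr_gt0.
  have lab : la <= lb by rewrite ler_pM2l // lef_pV2 ?posrE ?mulr_gt0 // ler_pM2l //; lra.
  have lb0 : 0 < lb by rewrite divr_gt0 // mulr_gt0.
  have bM : expR lb < M%:R.
    apply: le_lt_trans hM; rewrite ler_expR ler_pM2l // lef_pV2 ?posrE ?mulr_gt0 ?ltr0n // ler_pM2l //.
    have : (K2.+1%:R <= k%:R :> R) by rewrite ler_nat.
    by rewrite -natr1; lra.
  have ea : 1 <= expR la by rewrite -expR0 ler_expR.
  have eab : expR la <= expR lb by rewrite ler_expR.
  have := mertens_interval ea eab bM; rewrite !expRK => H.
  apply: (@le_trans _ _ ((lb - la - 6) / lb)).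
    have -> : (lb - la - 6) / lb = (1 - 2 * d) / (k%:R - d) - 12 * (k%:R - 1 + d) / L.
      by rewrite /la /lb; field; rewrite !gt_eqF.
    apply: lerB.
      by rewrite ler_wpM2l ?lef_pV2 ?posrE //; lra.
    by rewrite ler_wpM2r ?invr_ge0 ?(ltW L0) //; lra.
  apply: (@le_trans _ _ ((\sum_(0 <= p < M | prime p && (expR la <= p%:R <= expR lb)) ln p%:R / p%:R) / lb)).
    by rewrite ler_wpM2r ?invr_ge0 ?(ltW lb0).
  rewrite mulr_suml big_mkcond [leRHS]big_mkcond; apply: ler_sum => p _.
  case: ifP => [/andP[pp /andP[h1 h2]]|_]; last by case: ifP => // _; rewrite invr_ge0.
  have pR : (0 : R) < p%:R by rewrite ltr0n prime_gt0.
  have g1 : la <= ln p%:R by rewrite -(expRK la) ler_ln ?posrE ?expR_gt0.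
  have g2 : ln p%:R <= lb by rewrite -(expRK lb) ler_ln ?posrE ?expR_gt0.
  have lp0 : 0 < ln (p%:R : R) by rewrite ln_gt0 // ltr1n prime_gt1.
  have i1 : L <= (k%:R - d) * (2 * ln p%:R).
    by move: g1; rewrite /la ler_pdivrMr ?mulr_gt0 //; lra.
  have i2 : (k%:R - 1 + d) * (2 * ln p%:R) <= L.
    by move: g2; rewrite /lb ler_pdivlMr ?mulr_gt0 //; lra.
  have e : log_index L p = k.
    rewrite /log_index -[k]prednK; last by apply: leq_ltn_trans hk1.
    have kE : (k.-1%:R + 1 = k%:R :> R) by rewrite natr1 prednK //; apply: leq_ltn_trans hk1.
    have t0 : 0 <= L / (2 * ln p%:R) by rewrite divr_ge0 ?mulr_ge0 ?ltW.
    congr S; apply/eqP; rewrite eqn_leq truncn_le_nat truncn_ge_nat // -[k.-1.+1%:R]natr1 kE.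
    rewrite ltr_pdivrMr ?mulr_gt0 // ler_pdivlMr ?mulr_gt0 //.
    apply/andP; split; nra.
  rewrite /good_prime e eqxx pp hk1 hk2 i1 i2 /=.
  rewrite -[leRHS]mul1r mulrAC ler_wpM2r ?invr_ge0 ?(ltW pR) //.
  by rewrite ler_pdivrMr // mul1r.
apply: (@le_trans _ _ (\sum_(K2.+1 <= k < K1.+1) ((1 - 2 * d) * k%:R^-1 - 12 * k%:R / L))); last first.
  by apply: ler_sum_nat => k /andP[h1 h2]; apply: step.
rewrite sumrB -mulr_sumr; apply: lerB.
  by rewrite ler_wpM2l //; [lra|apply: harmonic_ge].
have -> : \sum_(K2.+1 <= k < K1.+1) 12 * k%:R / L = 12 / L * \sum_(K2.+1 <= k < K1.+1) k%:R :> R.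
  by rewrite mulr_sumr; apply: eq_bigr => k _; ring.
rewrite [leRHS]mulrAC ler_wpM2l ?divr_ge0 ?(ltW L0) //.
apply: (@le_trans _ _ (\sum_(K2.+1 <= k < K1.+1) K1%:R)).
  by apply: ler_sum_nat => k /andP[_ h]; rewrite ler_nat.
rewrite sumr_const_nat -[leLHS]mulr_natr expr2 ler_wpM2l // ler_nat; lia.
Qed.

(** * Choice of the parameters *)

Lemma expR_half_le2 (R : realType) : expR (2^-1) <= 2 :> R.
Proof.
have h := expR_ge1Dx (- 2^-1 : R).
have e : expR (2^-1) * expR (- 2^-1) = 1 :> R by rewrite -expRD subrr expR0.
have := expR_gt0 (2^-1 : R); nra.
Qed.

Lemma expR1_ge2 (R : realType) : 2 <= expR 1 :> R.
Proof. by have := expR_ge1Dx (1 : R); lra. Qed.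

Lemma expR3_le64 (R : realType) : expR 3 <= 64 :> R.
Proof.
have -> : 3 = 6%:R * 2^-1 :> R by lra.
rewrite expRM_natl (_ : 64 = 2 ^+ 6); last by rewrite !exprS expr0; lra.
by rewrite lerXn2r ?nnegrE ?expR_ge0 ?expR_half_le2.
Qed.

(** The tenth power of [expR (l / 20) >= l / 20] is [(l / 400) ^+ 5 * l ^+ 5]; the threshold on [l]
    is where [l / 400] reaches 10. *)
Lemma expR_half_large (R : realType) (l : R) :
  4 * 10 ^+ 3 <= l -> 10 ^+ 5 * l ^+ 5 <= expR (l / 2).
Proof.
move=> l1; have l0 : 0 <= l by apply: le_trans l1; rewrite mulr_ge0 ?exprn_ge0.
have -> : l / 2 = 10%:R * (l / 20) by field.
rewrite expRM_natl.
apply: (@le_trans _ _ ((l / 20) ^+ 10)).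
  have -> : (l / 20) ^+ 10 = (l / (20 * 20)) ^+ 5 * l ^+ 5 by field.
  rewrite ler_wpM2r ?exprn_ge0 // lerXn2r ?nnegrE //; first by rewrite divr_ge0.
  rewrite ler_pdivlMr //; apply: le_trans l1.
  by rewrite le_eqVlt; apply/orP; left; apply/eqP; rewrite !exprS expr0; ring.
rewrite lerXn2r ?nnegrE ?expR_ge0 ?divr_ge0 //.
by have := expR_ge1Dx (l / 20); lra.
Qed.

(** Brun's error grows with the sum of [1 / p], of which only a lower bound is established for the
    sieving primes. Sieving by a prefix bounds it on both sides, as each prime adds at most 1. *)
Lemma sum_inv_prefix (R : realType) (T : R) (ps : seq nat) : 0 <= T ->
  all prime ps -> T <= \sum_(p <- ps) p%:R^-1 ->
  exists n, T <= \sum_(p <- take n ps) p%:R^-1 <= T + 1.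
Proof.
move=> T0; elim/last_ind: ps => [|ps p IH] aps hT.
  by exists 0%N; rewrite take0 big_nil; move: hT; rewrite big_nil => hT; apply/andP; split; lra.
move: aps; rewrite all_rcons => /andP[pp aps].
have [h|h] := lerP T (\sum_(q <- ps) q%:R^-1).
  have [n /andP[h1 h2]] := IH aps h.
  have [nps|nps] := leqP n (size ps).
    by exists n; rewrite -cats1 takel_cat // h1 h2.
  by exists (size ps); rewrite -cats1 take_size_cat //; move: h1 h2; rewrite take_oversize ?h1 ?(ltnW nps) // => -> ->.
exists (size (rcons ps p)); rewrite take_size hT /=.
move: hT; rewrite -cats1 big_cat big_seq1 /= => hT.
have : p%:R^-1 <= 1 :> R by rewrite invf_le1 ?ltr0n ?ler1n prime_gt0.
lra.
Qed.

(** The threshold is computed from the upper end of the cell of [ln p], which has length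
    [1 / kappa], so it falls short of [Z = N / (w p)] by at most [Z / kappa]. *)
Lemma leftover_local_le (R : realType) (N y w p : nat) (kappa : R) :
  (0 < w)%N -> (0 < p)%N -> 0 < kappa -> kappa <= y%:R ->
  (size [seq q <- iota 0 N.+1 |
     [&& Num.trunc (N%:R / w%:R * expR (- ((Num.trunc (kappa * ln p%:R)).+1%:R / kappa)) : R) < q,
         y < q & w * p * q <= N]%N])%:R <= 2 / kappa * (N%:R / w%:R / p%:R) :> R.
Proof.
move=> w0 p0 k0 ky; set Qv := N%:R / w%:R * _; set s := [seq q <- _ | _].
have wR : (0 : R) < w%:R by rewrite ltr0n.
have pR : (0 : R) < p%:R by rewrite ltr0n.
set Z := N%:R / w%:R / p%:R.
have Z0 : 0 <= Z by rewrite !divr_ge0.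
have Qv0 : 0 <= Qv by rewrite mulr_ge0 ?divr_ge0 ?expR_ge0.
(* If some [q] is counted, then [kappa <= y < q <= Z], so the 1 lost to rounding is itself at most
   [Z / kappa]. *)
case E : s => [|q0 s']; first by rewrite /= mulr_ge0 // divr_ge0 // ltW.
have : q0 \in s by rewrite E mem_head.
rewrite mem_filter => /andP[/and3P[_ yq0 q0N] _].
have hZ (q : nat) : (w * p * q <= N)%N -> q%:R <= Z.
  by move=> h; rewrite /Z !ler_pdivlMr // -!natrM ler_nat mulnC mulnA mulnAC.
have kZ : kappa <= Z.
  by apply: le_trans ky _; apply: le_trans (hZ _ q0N); rewrite ler_nat ltnW.
rewrite -E.
have hs : (size s)%:R <= Z - Qv + 1.
  have : (size s <= Num.trunc Z - Num.trunc Qv)%N.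
    have -> : (Num.trunc Z - Num.trunc Qv = size (iota (Num.trunc Qv).+1 (Num.trunc Z - Num.trunc Qv)))%N.
      by rewrite size_iota.
    apply: uniq_leq_size; first by rewrite filter_uniq // iota_uniq.
    move=> q; rewrite mem_filter mem_iota => /andP[/and3P[h1 _ /hZ h2] _].
    have h3 : (q <= Num.trunc Z)%N by rewrite truncn_ge_nat.
    by rewrite mem_iota h1 /=; lia.
  rewrite -(ler_nat R) => h; apply: le_trans h _.
  have [le|lt] := leqP (Num.trunc Qv) (Num.trunc Z).
    rewrite natrB //.
    have a1 : (Num.trunc Z)%:R <= Z by rewrite -truncn_ge_nat.
    have a2 : Qv < (Num.trunc Qv)%:R + 1 by rewrite natr1 -truncn_le_nat.
    by lra.
  have -> : (Num.trunc Z - Num.trunc Qv = 0)%N by apply/eqP; rewrite subn_eq0 ltnW.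
  have : Qv <= Z; last by lra.
  rewrite /Qv /Z ler_wpM2l ?divr_ge0 // -[leRHS]lnK ?posrE ?invr_gt0 // ler_expR lnV ?posrE //.
  rewrite lerN2 ler_pdivlMr // mulrC ltW // -truncn_le_nat //.
apply: le_trans hs _.
have hQ : Z * (1 - kappa^-1) <= Qv.
  have -> : Qv = Z * (p%:R * expR (- ((Num.trunc (kappa * ln p%:R)).+1%:R / kappa))).
    by rewrite /Qv /Z; field; rewrite !gt_eqF.
  rewrite ler_wpM2l //; apply: le_trans (expR_ge1Dx _) _.
  have hp : p%:R = expR (ln p%:R) :> R by rewrite lnK.
  rewrite [X in _ <= X * _]hp -expRD ler_expR -natr1 mulrDl mul1r opprD.
  have : (Num.trunc (kappa * ln (p%:R : R)))%:R / kappa <= ln p%:R.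
    by rewrite ler_pdivrMr // mulrC -truncn_ge_nat // mulr_ge0 ?ln_nat_ge0 // ltW.
  by lra.
have kZ1 : 1 <= Z / kappa by rewrite ler_pdivlMr // mul1r.
have -> : 2 / kappa * Z = 2 * (Z / kappa) by ring.
by move: hQ; rewrite mulrBr mulr1; lra.
Qed.

(* Below [l] stands for [ln (ln m)], so that [expR l = ln m]. *)
Definition index_lo (R : realType) (l : R) : nat := (Num.trunc (l ^+ 2)).+1.

(** Index [k] means [ln p] about [expR l / (2 * k)]: this index marks the smallest sieving primes,
    [ln p] about [expR (l / 2) * l ^+ 3 / 2], and [index_lo] the largest, near [cutoff]. *)
Definition index_hi (R : realType) (l : R) : nat := Num.trunc (expR (l / 2) / l ^+ 3).

Definition cutoff (R : realType) (l : R) : nat :=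
  Num.trunc (expR (expR l / (2 * (index_lo l)%:R))).

(** The margin [l^-1] costs a factor [1 - 2 / l] in a sum of size about [l / 2], hence O(1), and
    earns [p ^ (- 1 / l)] in the bilinear sums before roots are taken. *)
Definition sieving_prime (R : realType) (l : R) : pred nat :=
  good_prime (expR l) l^-1 (index_lo l) (index_hi l).

(** * Sizes of the parameters *)

Lemma le1_expR (R : realType) (x : R) : 0 <= x -> 1 <= expR x.
Proof. by move=> x0; have := expR_ge1Dx x; lra. Qed.

Lemma expR_half_sqr (R : realType) (l : R) : expR l = expR (l / 2) * expR (l / 2).
Proof. by rewrite -expRD -splitr. Qed.

Lemma powers_large (R : realType) (l : R) : 4 * 10 ^+ 3 <= l ->
  100 <= l /\ [/\ 100 * l <= l ^+ 2, 100 * l ^+ 2 <= l ^+ 3, 100 * l ^+ 3 <= l ^+ 4,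
   100 * l ^+ 4 <= l ^+ 5 & 100 * l ^+ 5 <= expR (l / 2)].
Proof.
move=> hl; have l100 : 100 <= l.
  apply: le_trans hl; rewrite (_ : 10 ^+ 3 = 10 * 10 * 10); last by rewrite !exprS expr0; ring.
  by lra.
have step n : 100 * l ^+ n <= l ^+ n.+1.
  by rewrite exprS ler_wpM2r ?exprn_ge0 //; lra.
split=> //; split; rewrite ?step //.
  by have := step 1%N; rewrite expr1.
apply: le_trans (expR_half_large hl); rewrite ler_wpM2r ?exprn_ge0 //; first lra.
by rewrite (_ : 10 ^+ 5 = 10 * 10 * 10 * 10 * 10); last (rewrite !exprS expr0; ring); lra.
Qed.

Lemma index_lo_bounds (R : realType) (l : R) :
  l ^+ 2 <= (index_lo l)%:R /\ (index_lo l)%:R <= l ^+ 2 + 1.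
Proof.
have l0 : 0 <= l ^+ 2 by apply: sqr_ge0.
split; first by rewrite ltW // -truncn_le_nat.
by rewrite -natr1 lerD2r -truncn_ge_nat.
Qed.

Lemma index_hi_bounds (R : realType) (l : R) : 0 < l ->
  (index_hi l)%:R * l ^+ 3 <= expR (l / 2) /\ expR (l / 2) < (index_hi l).+1%:R * l ^+ 3.
Proof.
move=> l0; have l3 : 0 < l ^+ 3 by rewrite exprn_gt0.
rewrite -ler_pdivlMr // -ltr_pdivrMr // -truncn_le_nat -truncn_ge_nat //.
by rewrite divr_ge0 ?expR_ge0 ?ltW.
Qed.

Lemma cutoff_bounds (R : realType) (l : R) :
  (cutoff l)%:R <= expR (expR l / (2 * (index_lo l)%:R)) /\
  expR (expR l / (2 * (index_lo l)%:R)) < (cutoff l).+1%:R.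
Proof. by rewrite -truncn_le_nat -truncn_ge_nat ?expR_ge0. Qed.

Lemma cutoff_exponent_ge (R : realType) (l : R) : 4 * 10 ^+ 3 <= l ->
  10 * l <= expR l / (2 * (index_lo l)%:R).
Proof.
move=> hl; have [l1 [h2 h3 h4 h5 hE]] := powers_large hl.
have [k1 k2] := index_lo_bounds l.
have E1 : 1 <= expR (l / 2) by apply: le1_expR; lra.
have hL : expR (l / 2) <= expR l by rewrite [leRHS]expR_half_sqr ler_peMl ?expR_ge0.
have k0 : (0 : R) < (index_lo l)%:R by rewrite ltr0n.
rewrite ler_pdivlMr ?mulr_gt0 //.
have : 10 * l * (2 * (index_lo l)%:R) <= 10 * l * (2 * (l ^+ 2 + 1)).
  by rewrite ler_wpM2l ?ler_wpM2l //; lra.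
have -> : 10 * l * (2 * (l ^+ 2 + 1)) = 20 * l ^+ 3 + 20 * l by rewrite !exprS expr0; ring.
lra.
Qed.

Lemma cutoff_ge (R : realType) (l : R) : 4 * 10 ^+ 3 <= l -> expR (3 * l) <= (cutoff l)%:R.
Proof.
move=> hl; have [l1 _] := powers_large hl.
have [_ h] := cutoff_bounds l.
have := cutoff_exponent_ge hl; rewrite -ler_expR => h'.
have e1 : expR (10 * l) = expR (3 * l) * expR (7 * l) by rewrite -expRD; congr expR; lra.
have e2 : 2 <= expR (7 * l) by apply: le_trans (expR1_ge2 R) _; rewrite ler_expR; lra.
have e3 : 1 <= expR (3 * l) by apply: le1_expR; lra.
move: h; rewrite -natr1; nra.
Qed.

Lemma sieving_prime_le (R : realType) (l : R) (p : nat) : 4 * 10 ^+ 3 <= l ->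
  sieving_prime l p -> (p <= cutoff l)%N.
Proof.
move=> hl /and4P[pp /andP[k1 k2] h _]; have [l1 _] := powers_large hl.
have lp0 : 0 < ln (p%:R : R) by rewrite ln_gt0 // ltr1n prime_gt1.
have K20 : (0 : R) < (index_lo l)%:R by rewrite ltr0n.
rewrite truncn_ge_nat ?expR_ge0 // -[p%:R]lnK ?posrE ?ltr0n ?prime_gt0 // ler_expR.
rewrite ler_pdivlMr ?mulr_gt0 //; apply: le_trans h.
have : (index_lo l).+1%:R <= (log_index (expR l) p)%:R :> R by rewrite ler_nat.
have : 0 < l^-1 by rewrite invr_gt0; lra.
by rewrite -natr1; nra.
Qed.

(** [5 * ln l] is 3 from [index_hi] and 2 from [index_lo]. The 3 collects 1 for rounding [index_lo],
    1 for the factor [1 - 2 / l], and 1 for the Mertens errors [12 * K1 ^ 2 / L]. *)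
Lemma sum_sieving_prime_ge (R : realType) (l : R) : 4 * 10 ^+ 3 <= l ->
  l / 2 - 5 * ln l - 3 <= \sum_(0 <= p < (cutoff l).+1 | sieving_prime l p) p%:R^-1.
Proof.
move=> hl; have [l1 [h2 h3 h4 h5 hE]] := powers_large hl.
have [k1 k2] := index_lo_bounds l; have l0 : 0 < l by lra.
have [j1 j2] := index_hi_bounds l0.
have [_ cM] := cutoff_bounds l.
have d0 : 0 < l^-1 by rewrite invr_gt0.
have d2 : l^-1 < 2^-1 by rewrite ltf_pV2 ?posrE //; lra.
have l3 : 0 < l ^+ 3 by rewrite exprn_gt0.
have K12 : (index_lo l <= index_hi l)%N.
  rewrite -ltnS -(ltr_nat R) -(ltr_pM2r l3); apply: le_lt_trans j2.
  apply: (@le_trans _ _ ((l ^+ 2 + 1) * l ^+ 3)); first by rewrite ler_wpM2r // ltW.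
  have -> : (l ^+ 2 + 1) * l ^+ 3 = l ^+ 5 + l ^+ 3 by rewrite !exprS expr0; ring.
  lra.
have := sum_good_prime_ge (expR_gt0 l) d0 d2 (isT : (0 < index_lo l)%N) K12 cM.
apply: le_trans.
have a1 : l / 2 - 3 * ln l <= ln (index_hi l).+1%:R.
  have -> : l / 2 - 3 * ln l = ln (expR (l / 2) / l ^+ 3).
    by rewrite ln_div ?posrE ?expR_gt0 // expRK lnXn // -[ln l *+ 3]mulr_natl.
  by rewrite ler_ln ?posrE ?divr_gt0 ?expR_gt0 ?ltr0n // ler_pdivrMr //; apply: ltW.
have a2 : ln (index_lo l).+1%:R <= 1 + 2 * ln l.
  have -> : 1 + 2 * ln l = ln (expR 1 * l ^+ 2).
    by rewrite lnM ?posrE ?expR_gt0 ?exprn_gt0 // expRK lnXn // -[ln l *+ 2]mulr_natl.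
  rewrite ler_ln ?posrE ?mulr_gt0 ?expR_gt0 ?exprn_gt0 //.
  rewrite -natr1; have := expR1_ge2 R; nra.
have a3 : 12 * (index_hi l)%:R ^+ 2 / expR l <= 1.
  rewrite ler_pdivrMr ?expR_gt0 // mul1r expR_half_sqr.
  have i0 : (0 : R) <= (index_hi l)%:R by rewrite ler0n.
  have i1 : 12 * (index_hi l)%:R <= expR (l / 2).
    by apply: le_trans j1; rewrite mulrC ler_wpM2l //; lra.
  by rewrite expr2; nra.
set D := ln (index_hi l).+1%:R - ln (index_lo l).+1%:R.
have ln0 : 0 <= ln l by rewrite ln_ge0 //; lra.
have D0 : l / 2 - 5 * ln l - 1 <= D by rewrite /D; lra.
have b1 : (1 - 2 * l^-1) * (l / 2 - 5 * ln l - 1) <= (1 - 2 * l^-1) * D.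
  by rewrite ler_wpM2l //; lra.
have b2 : l / 2 - 5 * ln l - 2 <= (1 - 2 * l^-1) * (l / 2 - 5 * ln l - 1).
  have e : l^-1 * l = 1 by rewrite mulVf ?gt_eqF.
  have : 0 <= l^-1 * ln l by rewrite mulr_ge0 // ltW.
  by nra.
lra.
Qed.

Lemma expR_ge_sqr (R : realType) (l : R) : 4 * 10 ^+ 3 <= l -> 100 * l ^+ 2 <= expR l.
Proof.
move=> hl; have [l1 [h2 h3 h4 h5 hE]] := powers_large hl.
have E1 : 1 <= expR (l / 2) by apply: le1_expR; lra.
have : expR (l / 2) <= expR l by rewrite [leRHS]expR_half_sqr ler_peMl ?expR_ge0.
lra.
Qed.

(** * Bounds for the exceptional sets *)

(** One integer, about [c * l ^+ 2 / 2], serves both as Brun's order and as the exponent for smooth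
    numbers: its power of [cutoff l] stays below [m ^ (c / 4)], while [2 ^+ i] exceeds every power
    of [expR l] that occurs. *)
Lemma truncation_order (R : realType) (c l : R) : 4 * 10 ^+ 3 <= l -> 0 < c ->
  100 <= c * l -> exists i : nat, [/\ (0 < i)%N, expR (24 * l) <= 2 ^+ i,
    i%:R <= c * expR l / 4, i%:R * (expR l / (2 * (index_lo l)%:R)) <= c * expR l / 4 &
    l <= c * expR l / 2].
Proof.
move=> hl c0 hcl; have [l1 [h2 _ _ _ _]] := powers_large hl.
have [k1 _] := index_lo_bounds l.
have hL := expR_ge_sqr hl.
have cl2 : 100 * l <= c * l ^+ 2 by rewrite expr2 mulrA ler_wpM2r //; lra.
have cL : 100 * (c * l ^+ 2) <= c * expR l by rewrite mulrCA ler_wpM2l // ltW.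
have t0 : 0 <= c * l ^+ 2 / 2 by lra.
exists (Num.trunc (c * l ^+ 2 / 2)); set i := Num.trunc _.
have i1 : i%:R <= c * l ^+ 2 / 2 by rewrite -truncn_ge_nat.
have i2 : c * l ^+ 2 / 2 < i%:R + 1 by rewrite natr1 -truncn_le_nat.
split.
- by rewrite truncn_gt0; lra.
- apply: (@le_trans _ _ (expR (2^-1) ^+ i)); last by rewrite lerXn2r ?nnegrE ?expR_ge0 ?expR_half_le2.
  by rewrite -expRM_natl ler_expR; lra.
- lra.
- have k0 : (0 : R) < (index_lo l)%:R by rewrite ltr0n.
  rewrite mulrA ler_pdivrMr ?mulr_gt0 //.
  have -> : c * expR l / 4 * (2 * (index_lo l)%:R) = (c / 2 * (index_lo l)%:R) * expR l by field.
  rewrite ler_wpM2r ?expR_ge0 //; apply: le_trans i1 _.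
  by rewrite mulrAC ler_wpM2l //; lra.
- lra.
Qed.

Lemma smooth_bound (R : realType) (c l : R) (N : nat) : 4 * 10 ^+ 3 <= l -> 0 < c ->
  100 <= c * l -> expR (c * expR l) <= N%:R -> N%:R <= expR (expR l) ->
  (\sum_(1 <= n < N.+1 | smooth (cutoff l) n) 1)%N%:R <= 3 * (N%:R * expR (- l)) :> R.
Proof.
move=> hl c0 hcl hN1 hN2.
have [l1 [h2 _ _ _ _]] := powers_large hl.
have [i [i0 hi1 hi2 hi3 hcL]] := truncation_order hl c0 hcl.
have [y1 _] := cutoff_bounds l; have y2 := cutoff_ge hl.
have NR : (0 : R) < N%:R by apply: lt_le_trans hN1; apply: expR_gt0.
have N0 : (0 < N)%N by rewrite -(ltr0n R).
have yl : (1 < cutoff l)%N.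
  by rewrite -(ltr_nat R); apply: lt_le_trans y2; have := expR_gt1Dx (x := 3 * l); lra.
have lN : ln N%:R <= expR l by rewrite -[leRHS]expRK ler_ln ?posrE ?expR_gt0.
have NE : expR (c * expR l / 2) <= N%:R * expR (- l).
  apply: le_trans (_ : expR (c * expR l) * expR (- l) <= _); last by rewrite ler_wpM2r ?expR_ge0.
  by rewrite -expRD ler_expR; lra.
apply: le_trans (smooth_count_le R i yl N0) _.
have a1 : (cutoff l)%:R ^+ (2 * i) <= N%:R * expR (- l).
  apply: le_trans NE; apply: (@le_trans _ _ (expR (expR l / (2 * (index_lo l)%:R)) ^+ (2 * i))).
    by rewrite lerXn2r ?nnegrE ?expR_ge0.
  by rewrite -expRM_natl ler_expR natrM -mulrA; lra.
have a2 : N%:R * (1 + ln N%:R) / 2 ^+ i <= N%:R * expR (- l).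
  rewrite -mulrA ler_wpM2l ?(ltW NR) // ler_pdivrMr ?exprn_gt0 //.
  apply: (@le_trans _ _ (expR (- l) * expR (24 * l))); last by rewrite ler_wpM2l ?expR_ge0.
  rewrite -expRD; apply: (@le_trans _ _ (expR (1 + l))); last by rewrite ler_expR; lra.
  rewrite expRD; have := expR1_ge2 R; have : 1 <= expR l by apply: le1_expR; lra.
  by move: lN; nra.
have a3 : N%:R / (cutoff l)%:R <= N%:R * expR (- l).
  rewrite ler_wpM2l ?(ltW NR) // expRN lef_pV2 ?posrE ?expR_gt0 ?ltr0n ?(ltnW yl) //.
  by apply: le_trans y2; rewrite ler_expR; lra.
lra.
Qed.

Lemma sifted_bound (R : realType) (c l : R) (N : nat) : 4 * 10 ^+ 3 <= l -> 0 < c ->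
  100 <= c * l -> expR (c * expR l) <= N%:R ->
  (\sum_(1 <= n < N.+1 | ~~ has (sieving_prime l) (primes n)) 1)%N%:R <=
    N%:R * (64 * l ^+ 5 * expR (- (l / 2)) + 2 * expR (- l)) :> R.
Proof.
move=> hl c0 hcl hN1.
have [l1 [h2 h3 h4 h5 hE]] := powers_large hl.
have [i [i0 hi1 hi2 hi3 hcL]] := truncation_order hl c0 hcl.
have [y1 _] := cutoff_bounds l; have y2 := cutoff_ge hl.
have NR : (0 : R) < N%:R by apply: lt_le_trans hN1; apply: expR_gt0.
have l0 : 0 < l by lra.
have ll0 : 0 <= ln l by apply: ln_ge0; lra.
pose T := l / 2 - 5 * ln l - 3.
have T0 : 0 <= T.
  have : expR (5 * ln l + 3) <= expR (l / 2).
    rewrite expRD expRM_natl lnK ?posrE //.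
    have := expR3_le64 R; have l50 : 0 <= l ^+ 5 by rewrite exprn_ge0 // ltW.
    by move: hE; nra.
  by rewrite ler_expR /T; lra.
pose ps0 := [seq p <- iota 0 (cutoff l).+1 | sieving_prime l p].
have ps0E : \sum_(p <- ps0) p%:R^-1 = \sum_(0 <= p < (cutoff l).+1 | sieving_prime l p) p%:R^-1 :> R.
  by rewrite big_filter /index_iota subn0.
have aps0 : all prime ps0.
  by apply/allP => p; rewrite mem_filter => /andP[/and4P[]].
have [n /andP[s1 s2]] : exists n, T <= \sum_(p <- take n ps0) p%:R^-1 <= T + 1.
  by apply: sum_inv_prefix => //; rewrite ps0E; apply: sum_sieving_prime_ge.
set ps := take n ps0 in s1 s2.
have sub p : p \in ps -> p \in ps0 by move=> /mem_take.
have aps : all prime ps by apply/allP => p /sub; apply: (allP aps0).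
have ups : uniq ps by apply: take_uniq; rewrite filter_uniq // iota_uniq.
have sps : (size ps <= cutoff l)%N.
  apply: uniq_size_le => // p /sub; rewrite mem_filter mem_iota => /andP[/and4P[pp _ _ _]].
  by rewrite add0n ltnS prime_gt0.
have tN : Num.trunc (N%:R : R) = N by apply: truncn_def; rewrite lexx ltr_nat ltnSn.
have NE : expR (c * expR l / 2) <= N%:R * expR (- l).
  apply: le_trans (_ : expR (c * expR l) * expR (- l) <= _); last by rewrite ler_wpM2r ?expR_ge0.
  by rewrite -expRD ler_expR; lra.
(* Rankin's parameter is 2: as [s <= l / 2], the factor [expR (2 * s)] is far below [2 ^+ i]. *)
have two0 : (0 : R) < 2 by [].
have := brun two0 aps ups i (ltW NR); rewrite tN.
have := prod_sieve_le R aps; set V := \prod_(p <- ps) _; set s := \sum_(p <- ps) _.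
move=> hV /ler_normlP[_ hB].
apply: (@le_trans _ _ (\sum_(1 <= n < N.+1 | sifted ps n) 1)%N%:R).
  rewrite ler_nat big_mkcond [leqRHS]big_mkcond; apply: leq_sum_seq => k.
  rewrite mem_index_iota => /andP[k0 _] _; case: ifP => // nP; rewrite (_ : sifted ps k) //.
  apply/allP => p pps; apply: contra nP => pk; apply/hasP; exists p.
    by rewrite mem_primes pk k0 (allP aps).
  by have := sub _ pps; rewrite mem_filter => /andP[].
have bV : V <= 64 * l ^+ 5 * expR (- (l / 2)).
  apply: le_trans hV _; apply: (@le_trans _ _ (expR (3 + 5%:R * ln l - l / 2))).
    by rewrite ler_expR; move: s1; rewrite /T -/s; lra.
  rewrite expRD [expR (3 + _)]expRD expRM_natl lnK ?posrE // ler_wpM2r ?expR_ge0 // ler_wpM2r ?exprn_ge0 ?(ltW l0) //.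
  exact: expR3_le64.
have b2 : N%:R * expR (2 * s) / 2 ^+ i <= N%:R * expR (- l).
  rewrite -mulrA ler_wpM2l ?(ltW NR) // ler_pdivrMr ?exprn_gt0 //.
  apply: (@le_trans _ _ (expR (- l) * expR (24 * l))); last by rewrite ler_wpM2l ?expR_ge0.
  by rewrite -expRD ler_expR; move: s2; rewrite /T -/s; lra.
have b3 : (size ps).+1%:R ^+ i <= N%:R * expR (- l).
  apply: le_trans NE; apply: (@le_trans _ _ (expR (1 + expR l / (2 * (index_lo l)%:R)) ^+ i)).
    rewrite lerXn2r ?nnegrE ?expR_ge0 //; apply: (@le_trans _ _ (2 * expR (expR l / (2 * (index_lo l)%:R)))).
      have : 1 <= expR (expR l / (2 * (index_lo l)%:R)).
        by apply: le1_expR; have := cutoff_exponent_ge hl; lra.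
      have : (size ps)%:R <= (cutoff l)%:R :> R by rewrite ler_nat.
      by rewrite -natr1; move: y1; lra.
    by rewrite expRD ler_wpM2r ?expR_ge0 ?expR1_ge2.
  by rewrite -expRM_natl ler_expR mulrDr mulr1; lra.
have bNV : N%:R * V <= N%:R * (64 * l ^+ 5 * expR (- (l / 2))) by rewrite ler_wpM2l ?(ltW NR).
by move: hB b2 b3 bNV; lra.
Qed.

(** * The bilinear saving on one cell *)

(** The left side is at most [55 * (k * l ^+ 3)], mostly from the last term, hence at most
    [55 * expR (l / 2)] by the choice of [index_hi]; the right side is at least
    [expR (l / 2) * l ^+ 2 / 2]. *)
Lemma saving_condition (R : realType) (l lx : R) (k r : nat) :
  4 * 10 ^+ 3 <= l -> (0 < k)%N -> (0 < r)%N -> k%:R * l ^+ 3 <= expR (l / 2) ->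
  r%:R <= 3 * l ^+ 2 -> expR (l / 2) * l ^+ 3 / 2 <= lx ->
  k%:R * (ln k%:R + 2) + r%:R * (ln r%:R + 2) + 2 * k%:R * r%:R * (8 * l) <= l^-1 * lx.
Proof.
move=> hl k0 r0 kE rl lxE.
have [l1 [h2 h3 _ _ _]] := powers_large hl; have hL := expR_ge_sqr hl.
have l0 : 0 < l by lra.
have kR : 1 <= k%:R :> R by rewrite ler1n.
have rR : (0 : R) < r%:R by rewrite ltr0n.
have l31 : 1 <= l ^+ 3 by lra.
have kE' : k%:R <= expR (l / 2).
  by apply: le_trans kE; rewrite ler_peMr // ltW // (lt_le_trans _ kR).
have lnk : ln k%:R <= l / 2.
  by rewrite -[leRHS]expRK ler_ln ?posrE ?expR_gt0 ?ltr0n.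
have rE : r%:R <= expR l by lra.
have lnr : ln r%:R <= l by rewrite -[leRHS]expRK ler_ln ?posrE ?expR_gt0.
have b1 : k%:R * (ln k%:R + 2) <= k%:R * l ^+ 3 by rewrite ler_wpM2l //; lra.
have kl3 : l ^+ 3 <= k%:R * l ^+ 3 by rewrite ler_peMl //; lra.
have b2 : r%:R * (ln r%:R + 2) <= 6 * (k%:R * l ^+ 3).
  apply: (@le_trans _ _ (3 * l ^+ 2 * (2 * l))).
    have c1 : 0 <= ln (r%:R : R) + 2 by apply: addr_ge0 => //; apply: ln_nat_ge0.
    have c2 : ln r%:R + 2 <= 2 * l by move: lnr l1; clear; lra.
    by apply: ler_pM.
  by have -> : 3 * l ^+ 2 * (2 * l) = 6 * l ^+ 3 by [rewrite !exprS expr0; ring]; lra.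
have b3 : 2 * k%:R * r%:R * (8 * l) <= 48 * (k%:R * l ^+ 3).
  have -> : 48 * (k%:R * l ^+ 3) = (2 * k%:R * (8 * l)) * (3 * l ^+ 2).
    by rewrite !exprS expr0; ring.
  have -> : 2 * k%:R * r%:R * (8 * l) = (2 * k%:R * (8 * l)) * r%:R by ring.
  by rewrite ler_wpM2l // !mulr_ge0 //; lra.
have b4 : expR (l / 2) * l ^+ 2 / 2 <= l^-1 * lx.
  rewrite [leRHS]mulrC ler_pdivlMr //; apply: le_trans lxE.
  by rewrite le_eqVlt; apply/orP; left; apply/eqP; rewrite !exprS expr0; ring.
have b5 : 55 * expR (l / 2) <= expR (l / 2) * l ^+ 2 / 2.
  have : 0 <= expR (l / 2) * (l ^+ 2 / 2 - 55) by rewrite mulr_ge0 ?expR_ge0 //; lra.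
  by lra.
lra.
Qed.

(** [r] is the exponent with [Y ^ (2 r - 2) <= m <= Y ^ (2 r)] when [y = ln Y]. It is small because
    [q] exceeds [cutoff l], which makes [r - 1] at most [2 * index_lo l]. *)
Lemma level_exists (R : realType) (l y : R) : 4 * 10 ^+ 3 <= l ->
  expR l / (2 * (index_lo l)%:R) / 2 <= y ->
  exists r : nat, [/\ (0 < r)%N, expR l <= 2 * r%:R * y, (2 * r%:R - 2) * y <= expR l &
    r%:R <= 3 * l ^+ 2].
Proof.
move=> hl; have [l1 [h2 _ _ _ _]] := powers_large hl.
have [_ k2] := index_lo_bounds l; have := cutoff_exponent_ge hl.
set Z := expR l / (2 * (index_lo l)%:R) => Zl lnY; have lnY0 : 0 < y by lra.
pose r := (Num.trunc (expR l / (2 * y))).+1.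
have t0 : 0 <= expR l / (2 * y) by rewrite divr_ge0 ?expR_ge0 ?mulr_ge0 ?ltW.
have r1 : expR l <= 2 * r%:R * y.
  have : expR l / (2 * y) < r%:R by rewrite -truncn_le_nat.
  by rewrite ltr_pdivrMr ?mulr_gt0 //; lra.
have r2' : (r%:R - 1) * (2 * y) <= expR l.
  by rewrite -ler_pdivlMr ?mulr_gt0 // /r -natr1 addrK -truncn_ge_nat.
have r2 : (2 * r%:R - 2) * y <= expR l by lra.
have r0 : 1 <= r%:R :> R by rewrite ler1n.
have rl : r%:R <= 3 * l ^+ 2.
  have K20 : (0 : R) < (index_lo l)%:R by rewrite ltr0n.
  have e : expR l = Z * (2 * (index_lo l)%:R).
    by rewrite /Z divfK // gt_eqF // mulr_gt0.
  have : (r%:R - 1) * Z <= Z * (2 * (index_lo l)%:R).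
    rewrite -e; apply: le_trans r2'; rewrite ler_wpM2l //; lra.
  rewrite mulrC ler_pM2l; last lra.
  lra.
by exists r.
Qed.

Lemma cell_bilinear_le (R : realType) (l : R) (m N b X Y : nat) (A B : seq nat) :
  4 * 10 ^+ 3 <= l -> (1 < m)%N -> ln m%:R = expR l ->
  coprime b m -> uniq A -> uniq B -> X \in A -> (0 < Y)%N ->
  (forall p, p \in A -> [/\ sieving_prime l p, prime p, coprime p m &
     Num.trunc (expR (3 * l) * ln p%:R) = Num.trunc (expR (3 * l) * ln X%:R)]) ->
  (forall q, q \in B -> [/\ prime q, (cutoff l < q <= N)%N, (Y <= q <= 2 * Y)%N & coprime q m]) ->
  normc (\sum_(p <- A) \sum_(q <- B) ec R m (b * modinv m p * modinv m q)%N) <=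
    4 * expR (- (8 * l)) * (X%:R * Y%:R).
Proof.
move=> hl m1 hm cb uA uB XA Y0 HA HB.
have [l1 [h2 h3 h4 h5 hE]] := powers_large hl; have l0 : 0 < l by lra.
have hL := expR_ge_sqr hl.
have [k1 k2] := index_lo_bounds l.
have [j1 _] := index_hi_bounds l0.
have [_ y1] := cutoff_bounds l; have y2 := cutoff_ge hl.
(* A member of [B] exceeds [cutoff l] and so bounds [Y] from below; the empty sum is set apart. *)
case EB : B => [|q0 B'].
  under eq_bigr do rewrite big_nil.
  by rewrite big1 // ComplexField.Normc.normc0 !mulr_ge0 ?expR_ge0.
have q0B : q0 \in B by rewrite EB mem_head.
rewrite -EB.
(* The given [X] is any member of the cell. The least one, [X0], puts [A] into [[X0, 2 * X0]], and
   being a sieving prime it supplies the exponent [k] with its margins; the bound for [X0] implies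
   the one for [X]. *)
have [X0 X0A X0min] : exists2 X0, X0 \in A & forall p, p \in A -> (X0 <= p)%N.
  have ex : exists n, n \in A by exists X.
  by case: (ex_minnP ex) => X0 X0A X0min; exists X0.
have [/and4P[pX0 /andP[_ kK] kX1 kX2] _ _ _] := HA _ X0A.
set k := log_index (expR l) X0 in kK kX1 kX2.
have X0R : (0 : R) < X0%:R by rewrite ltr0n prime_gt0.
have lX0 : 0 < ln (X0%:R : R) by rewrite ln_gt0 // ltr1n prime_gt1.
have kR : 1 <= k%:R :> R by rewrite ler1n.
have d0 : 0 < l^-1 by rewrite invr_gt0.
have kE : k%:R * l ^+ 3 <= expR (l / 2).
  by apply: le_trans j1; rewrite ler_wpM2r ?ler_nat // exprn_ge0 // ltW.
have E0 : 0 < expR (l / 2) by apply: expR_gt0.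
have lX0E : expR (l / 2) * l ^+ 3 / 2 <= ln X0%:R.
  have h : expR (l / 2) * expR (l / 2) <= 2 * k%:R * ln X0%:R.
    rewrite -expR_half_sqr; apply: le_trans kX2 _.
    by rewrite mulrBl; have := mulr_gt0 d0 lX0; lra.
  have h' : expR (l / 2) * (k%:R * l ^+ 3) <= expR (l / 2) * expR (l / 2).
    by rewrite ler_wpM2l // ltW.
  have kp : 0 < k%:R :> R by lra.
  rewrite -(ler_pM2l kp); lra.
have l31 : 2 <= l ^+ 3 by lra.
have El3 : expR (l / 2) <= expR (l / 2) * l ^+ 3 / 2 by rewrite -mulrA ler_peMr ?expR_ge0 //; lra.
have kE' : k%:R <= expR (l / 2).
  by apply: le_trans kE; rewrite ler_peMr //; lra.
have kX0 : (k < X0)%N.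
  rewrite -(ltr_nat R); apply: le_lt_trans (ln_sublinear X0R); lra.
have close p : p \in A -> (X0 <= p <= 2 * X0)%N.
  move=> pA; rewrite X0min //= -(ler_nat R) natrM.
  have [_ pp _ e1] := HA _ pA; have [_ _ _ e2] := HA _ X0A.
  have pR : (0 : R) < p%:R by rewrite ltr0n prime_gt0.
  have lp0 : 0 <= ln (p%:R : R) by apply: ln_nat_ge0.
  set ka := expR (3 * l) in e1 e2.
  have ka2 : 2 <= ka by apply: le_trans (expR1_ge2 R) _; rewrite ler_expR; lra.
  have a1 : (Num.trunc (ka * ln (p%:R : R)))%:R <= ka * ln X0%:R.
    by rewrite e1 -e2 -truncn_ge_nat // mulr_ge0 //; [lra | exact: ltW].
  have a2 : ka * ln p%:R < (Num.trunc (ka * ln (p%:R : R)))%:R + 1.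
    by rewrite natr1 -truncn_le_nat.
  have a3 : ln p%:R <= ln X0%:R + 2^-1 :> R.
    have kp : 0 < ka by apply: expR_gt0.
    by rewrite -(ler_pM2l kp) mulrDr; lra.
  rewrite -[leLHS]lnK ?posrE //.
  apply: (@le_trans _ _ (expR (ln X0%:R + 2^-1))); first by rewrite ler_expR.
  by rewrite expRD lnK ?posrE // mulrC ler_wpM2r ?(ltW X0R) ?expR_half_le2.
have Y0R : (0 : R) < Y%:R by rewrite ltr0n.
have [_ /andP[yq _] /andP[_ qY] _] := HB _ q0B.
set Z := expR l / (2 * (index_lo l)%:R) in y1.
have Zl : 10 * l <= Z by apply: cutoff_exponent_ge.
have lnY : Z / 2 <= ln Y%:R.
  have h : expR Z <= 2 * Y%:R.
    apply: le_trans (ltW y1) _; rewrite -natrM ler_nat; exact: leq_trans yq qY.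
  have : Z <= ln (2 * Y%:R) by rewrite -[leLHS]expRK ler_ln ?posrE ?expR_gt0 ?mulr_gt0.
  by rewrite lnM ?posrE //; have := ln2_le1 R; lra.
have [r [r00 r1 r2 rl]] := level_exists hl lnY.
have r0' : (0 : R) < r%:R by rewrite ltr0n.
have rE : r%:R <= expR l by lra.
have rq q : q \in B -> (r < q)%N.
  move=> /HB[_ /andP[yq' _] _ _]; apply: leq_ltn_trans yq'.
  rewrite -(ler_nat R); apply: le_trans y2; apply: le_trans rE _.
  by rewrite ler_expR; lra.
apply: (@le_trans _ _ (4 * expR (- (8 * l)) * (X0%:R * Y%:R))); last first.
  by rewrite ler_wpM2l ?mulr_ge0 ?expR_ge0 // ler_wpM2r ?(ltW Y0R) // ler_nat X0min.
apply: (@bilinear_primes_le R m b k r X0 Y A B l^-1) => //.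
- exact: prime_gt0.
- move=> p pA; have [_ pp cp _] := HA _ pA; split=> //; last exact: close.
  by apply: leq_trans kX0 _; apply: X0min.
- by move=> q qB; have [pq _ qY' cq] := HB _ qB; split=> //; apply: rq.
- by rewrite hm; apply: le_trans kX2 _; lra.
- by rewrite hm; apply: le_trans kX1; lra.
- by rewrite hm.
- by rewrite hm.
exact: saving_condition.
Qed.

(** * The bound for N at most m *)

Lemma kloosterman_mid_le (R : realType) (c l : R) (m N : nat) (a : int) :
  4 * 10 ^+ 3 <= l -> 0 < c -> 100 <= c * l -> ln m%:R = expR l ->
  coprimez a m -> expR (c * expR l) <= N%:R -> (N <= m)%N ->
  normc (kloosterman_sum R m N a) <= 3 / 4 * (l ^+ 6 * expR (- (l / 2))) * N%:R.
Proof.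
move=> hl c0 hcl hm ca hN1 Nm.
have [l1 [h2 h3 h4 h5 hE]] := powers_large hl; have l0 : 0 < l by lra.
have NR : (0 : R) < N%:R by apply: lt_le_trans hN1; apply: expR_gt0.
have N0 : (0 < N)%N by rewrite -(ltr0n R).
have mR : (0 : R) < m%:R by rewrite ltr0n (leq_trans N0).
have mE : m%:R = expR (expR l) :> R by rewrite -hm lnK.
have m1 : (1 < m)%N by rewrite -(ltr_nat R) mE expR_gt1 expR_gt0.
have hN2 : N%:R <= expR (expR l) by rewrite -mE ler_nat.
have lN : ln N%:R <= expR l by rewrite -[leRHS]expRK ler_ln ?posrE ?expR_gt0.
have lN0 : 0 <= ln (N%:R : R) by apply: ln_nat_ge0.
have L1 : 1 <= expR l by apply: le1_expR; lra.
(* Cells of length [expR (- 3 l)] in [ln p] are short enough for the leftover count to beat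
   [(1 + ln N) ^+ 2], and their number, about [expR (4 * l)], is covered by the saving
   [expR (- 8 l)]. *)
pose ka := expR (3 * l).
have ka0 : 0 < ka by apply: expR_gt0.
pose cl p := Num.trunc (ka * ln (p%:R : R)).
pose Q w j := Num.trunc (N%:R / w%:R * expR (- (j.+1%:R / ka)) : R).
pose J := (Num.trunc (ka * expR l)).+1.
have eps0 : 0 <= 2 / ka by rewrite divr_ge0 // ltW.
have tau0 : 0 <= 4 * expR (- (8 * l)) by rewrite mulr_ge0 ?expR_ge0.
have HQ w p q : (0 < w)%N -> (q <= Q w (cl p))%N -> (w * p * q <= N)%N.
  move=> w0; have [->|p0] := posnP p; first by rewrite muln0 mul0n.
  have wR : (0 : R) < w%:R by rewrite ltr0n.
  have pR : (0 : R) < p%:R by rewrite ltr0n.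
  rewrite truncn_ge_nat ?mulr_ge0 ?divr_ge0 ?expR_ge0 // => h.
  have pe : p%:R <= expR ((cl p).+1%:R / ka).
    rewrite -[leLHS]lnK ?posrE // ler_expR ler_pdivlMr // mulrC ltW // -truncn_le_nat //.
  rewrite -(ler_nat R) !natrM.
  apply: (@le_trans _ _ (w%:R * expR ((cl p).+1%:R / ka) * (N%:R / w%:R * expR (- ((cl p).+1%:R / ka))))).
    apply: ler_pM => //; rewrite ?mulr_ge0 //; apply: ler_wpM2l => //.
  have e : expR ((cl p).+1%:R / ka) * expR (- ((cl p).+1%:R / ka)) = 1 by rewrite -expRD subrr expR0.
  rewrite (_ : _ * _ = N%:R * (expR ((cl p).+1%:R / ka) * expR (- ((cl p).+1%:R / ka)))).
    by rewrite e mulr1.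
  by field; rewrite gt_eqF.
have HJ p : sieving_prime l p -> (cl p < J)%N.
  move=> Pp; rewrite ltnS; apply: le_truncn; rewrite ler_pM2l //.
  have pc := sieving_prime_le hl Pp; have /and4P[pp _ _ _] := Pp.
  rewrite -[leRHS]expRK ler_ln ?posrE ?expR_gt0 ?ltr0n ?prime_gt0 //.
  have [y1 _] := cutoff_bounds l.
  apply: (@le_trans _ _ (cutoff l)%:R); first by rewrite ler_nat.
  apply: le_trans y1 _; rewrite ler_expR.
  have k0 : (1 : R) <= (index_lo l)%:R by rewrite ler1n.
  rewrite ler_pdivrMr ?mulr_gt0 ?ltr0n //.
  by rewrite ler_peMr ?expR_ge0 //; lra.
have Hleft w p : (0 < w)%N -> (0 < p)%N -> sieving_prime l p ->
    (size [seq q <- iota 0 N.+1 | [&& Q w (cl p) < q, cutoff l < q & w * p * q <= N]%N])%:R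
      <= 2 / ka * (N%:R / w%:R / p%:R).
  by move=> w0 p0 _; apply: leftover_local_le => //; apply: cutoff_ge.
have := @kloosterman_core R m N (cutoff l) J a (sieving_prime l) cl Q _ _ m1 N0 eps0 tau0
  ca (fun p => @sieving_prime_le R l p hl) HQ HJ Hleft
  (fun b A B X Y cb uA uB XA Y0 HA HB => @cell_bilinear_le R l m N b X Y A B hl m1 hm cb uA uB XA Y0 HA HB).
move/le_trans; apply.
have e1 := sifted_bound hl c0 hcl hN1.
have e2 := smooth_bound hl c0 hcl hN1 hN2.
have N1 : 1 + ln N%:R <= 2 * expR l by lra.
have N1' : 0 <= 1 + ln (N%:R : R) by lra.
have e3 : 2 / ka * (N%:R * (1 + ln N%:R) ^+ 2) <= 8 * (N%:R * expR (- l)).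
  apply: (@le_trans _ _ (2 / ka * (N%:R * (2 * expR l) ^+ 2))).
    by rewrite ler_wpM2l // ler_wpM2l ?(ltW NR) // lerXn2r ?nnegrE ?mulr_ge0 ?expR_ge0.
  rewrite /ka -expRN (_ : 2 * expR (- (3 * l)) * (N%:R * (2 * expR l) ^+ 2) =
    8 * (N%:R * (expR (- (3 * l)) * (expR l * expR l)))); last by ring.
  by rewrite -!expRD ler_pM2l // ler_pM2l // ler_expR; lra.
have e4 : 4 * expR (- (8 * l)) * (N%:R * (1 + ln N%:R)) * J%:R * (trunc_log 2 N).+1%:R <=
    48 * (N%:R * expR (- l)).
  have i1 : J%:R <= 2 * expR (4 * l).
    have e : expR (4 * l) = ka * expR l by rewrite /ka -expRD; congr expR; lra.
    rewrite /J -natr1 e; have : (Num.trunc (ka * expR l))%:R <= ka * expR l.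
      by rewrite -truncn_ge_nat // mulr_ge0 ?expR_ge0.
    have : 1 <= ka * expR l by rewrite -e; apply: le1_expR; lra.
    lra.
  have i2 : (trunc_log 2 N).+1%:R <= 3 * expR l.
    have h : ln (2 ^+ trunc_log 2 N) <= ln (N%:R : R).
      rewrite ler_ln ?posrE ?exprn_gt0 // -natrX ler_nat.
      by have /andP[] := trunc_log_bounds (isT : 1 < 2)%N N0.
    move: h; rewrite lnXn // -[ln 2 *+ _]mulr_natl -natr1 => h.
    have ln2 : 2^-1 <= ln (2 : R).
      by rewrite -[leLHS]expRK ler_ln ?posrE ?expR_gt0 ?expR_half_le2.
    have : (trunc_log 2 N)%:R * 2^-1 <= (trunc_log 2 N)%:R * ln (2 : R) by rewrite ler_wpM2l.
    by lra.
  apply: (@le_trans _ _ (4 * expR (- (8 * l)) * (N%:R * (2 * expR l)) * (2 * expR (4 * l)) * (3 * expR l))).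
    apply: ler_pM => //; rewrite ?mulr_ge0 ?expR_ge0 //.
    apply: ler_pM => //; rewrite ?mulr_ge0 ?expR_ge0 //.
    by rewrite ler_wpM2l // ler_wpM2l // ltW.
  rewrite (_ : _ * (3 * expR l) = 48 * (N%:R * (expR (- (8 * l)) * (expR l * (expR (4 * l) * expR l))))); last by ring.
  by rewrite -!expRD ler_pM2l // ler_pM2l // ler_expR; lra.
have ee : expR (- l) <= expR (- (l / 2)) by rewrite ler_expR; lra.
set x := expR (- (l / 2)) in e1 ee *; set z := expR (- l) in e1 e2 e3 e4 ee.
have x0 : 0 <= x by apply: expR_ge0.
have Nz : N%:R * z <= N%:R * x by rewrite ler_wpM2l ?(ltW NR).
have Nx0 : 0 <= N%:R * x by rewrite mulr_ge0 // ltW.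
(* 61 is 2 + 3 + 8 + 48: the sieve errors, smooth numbers, leftovers and rectangles. The factor 3/4
   leaves room for strictness and for the extra term when [N > m]. *)
have l6 : 64 * l ^+ 5 + 61 <= 3 / 4 * l ^+ 6.
  have : 100 * l ^+ 5 <= l ^+ 6 by rewrite [leRHS]exprS ler_wpM2r // exprn_ge0 // ltW.
  lra.
have := ler_wpM2l Nx0 l6.
rewrite (_ : 3 / 4 * (l ^+ 6 * x) * N%:R = N%:R * x * (3 / 4 * l ^+ 6)); last by ring.
rewrite mulrDr in e1; lra.
Qed.

(** * Periodicity and the range N > m *)

Lemma kloosterman_sumD (R : realType) (m N : nat) (a : int) : (0 < m)%N ->
  kloosterman_sum R m (m + N) a = kloosterman_sum R m m a + kloosterman_sum R m N a.
Proof.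
move=> m0; rewrite /kloosterman_sum (@big_cat_nat _ _ _ m.+1) //=; last first.
  by rewrite ltnS leq_addr.
congr (_ + _); rewrite -[m.+1]add1n big_addn (_ : (m + N).+1 - m = N.+1)%N; last by rewrite -addnS addKn.
rewrite [LHS]big_mkcond [RHS]big_mkcond.
rewrite big_nat [RHS]big_nat; apply: eq_bigr => n /andP[n0 _].
rewrite -coprime_modl modnDr coprime_modl; case: ifP => // co.
rewrite -/(ec R m _) -/(ec R m _); apply: ec_mod => //.
rewrite -modzMmr -[RHS]modzMmr !modz_nat; congr ((_ * Posz _) %% _)%Z.
apply/esym; apply: modinv_uniq; rewrite ?addn_gt0 ?n0 //.
  by rewrite -coprime_modl modnDr coprime_modl.
by rewrite mulnDl (mulnC m) addnC modnMDl modinvP.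
Qed.

Lemma normc_kloosterman_le (R : realType) (m N : nat) (a : int) :
  normc (kloosterman_sum R m N a) <= N%:R.
Proof.
have := @normc_count_le R (index_iota 1 N.+1) (fun n => coprime n m) xpredT
  (fun n => ec R m (a * (modinv m n)%:Z)) (fun n => _) (fun n _ _ => isT).
rewrite sum_nat_const_nat subSS subn0 muln1; apply => n.
by rewrite normc_ec.
Qed.

(** Whole periods are split off, and bounds linear in [N] add up. The extra term is the trivial
    bound for a last piece shorter than [m ^ c], incurred once. *)
Lemma kloosterman_all_le (R : realType) (c l : R) (m : nat) (a : int) :
  4 * 10 ^+ 3 <= l -> 0 < c -> c < 1 -> 100 <= c * l -> ln m%:R = expR l ->
  coprimez a m -> forall N : nat,
  normc (kloosterman_sum R m N a) <=
    3 / 4 * (l ^+ 6 * expR (- (l / 2))) * N%:R + expR (c * expR l).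
Proof.
move=> hl c0 c1 hcl hm ca.
have l0 : 0 < l by have [? _] := powers_large hl; lra.
have b0 : 0 <= 3 / 4 * (l ^+ 6 * expR (- (l / 2))).
  by rewrite mulr_ge0 // mulr_ge0 ?expR_ge0 // exprn_ge0 // ltW.
have m0 : (0 < m)%N.
  by case: m hm {ca} => // h; have := expR_gt0 l; rewrite -h ln0 // ltxx.
have mE : m%:R = expR (expR l) :> R by rewrite -hm lnK // posrE ltr0n.
elim/ltn_ind => N IH.
have [Nm|mN] := leqP N m.
  have [h|h] := lerP (expR (c * expR l)) N%:R.
    apply: le_trans (kloosterman_mid_le hl c0 hcl hm ca h Nm) _.
    by rewrite lerDl expR_ge0.
  apply: le_trans (normc_kloosterman_le _ _ _ _) _; apply: le_trans (ltW h) _.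
  by rewrite lerDr mulr_ge0.
rewrite -(subnKC (ltnW mN)) kloosterman_sumD //.
apply: le_trans (ler_normcD _ _) _.
have h1 : normc (kloosterman_sum R m m a) <= 3 / 4 * (l ^+ 6 * expR (- (l / 2))) * m%:R.
  apply: (@kloosterman_mid_le R c) => //.
  by rewrite mE ler_expR; have := expR_gt0 l; nra.
have h2 := IH (N - m)%N (_ : (N - m < N)%N).
apply: le_trans (lerD h1 (h2 _)) _.
  by rewrite ltn_subrL m0 (leq_trans _ mN).
by rewrite natrD mulrDr addrA.
Qed.

Theorem theorem5 (R : realType) (c : R) (hc0 : 0 < c) (hc1 : c < 1) :
  exists (C : R) (m0 : nat), 0 < C /\
    forall m N : nat, (m0 <= m)%N -> (m%:R : R) `^ c < N%:R ->
    forall a : int, coprimez a m%:Z ->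
      ComplexField.Normc.normc (kloosterman_sum R m N a) <
        ln (ln m%:R) `^ C / ln m%:R `^ 2^-1 * N%:R.
Proof.
(* Dividing by [c * (1 - c)] makes [l], [c * l] and [(1 - c) * l] large at once. *)
pose l0 : R := 4 * 10 ^+ 3 / (c * (1 - c)).
exists 6, (Num.trunc (expR (expR l0))).+1; split=> // m N hm hN a ca.
have hmR : expR (expR l0) < m%:R.
  by apply: lt_le_trans (_ : (Num.trunc (expR (expR l0))).+1%:R <= _); rewrite ?ler_nat // -truncn_le_nat.
have mR : (0 : R) < m%:R by apply: lt_trans hmR; apply: expR_gt0.
have L0 : expR l0 < ln m%:R.
  by rewrite -[ltLHS]expRK ltr_ln ?posrE ?expR_gt0.
have Lp : 0 < ln (m%:R : R) by apply: lt_trans L0; apply: expR_gt0.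
pose l := ln (ln (m%:R : R)).
have hl0 : l0 < l by rewrite -[ltLHS]expRK ltr_ln ?posrE ?expR_gt0.
have eL : ln m%:R = expR l by rewrite lnK.
have c1 : 0 < 1 - c by rewrite subr_gt0.
have cc : 0 < c * (1 - c) by rewrite mulr_gt0.
have K0 : (0 : R) <= 4 * 10 ^+ 3 by rewrite mulr_ge0 ?exprn_ge0.
have hcl : 4 * 10 ^+ 3 <= c * (1 - c) * l.
  by rewrite [leRHS]mulrC -ler_pdivrMr //; apply: ltW.
have lp : 0 < l.
  by apply: le_lt_trans hl0; rewrite divr_ge0 // ltW.
have hl : 4 * 10 ^+ 3 <= l.
  by apply: le_trans hcl _; rewrite ler_piMl ?(ltW lp) //; nra.
have [l1 _] := powers_large hl.
have hcl1 : 100 <= c * l.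
  have [h _] := powers_large hcl; apply: le_trans h _.
  by rewrite ler_wpM2r ?(ltW lp) // ler_piMr ?(ltW hc0) //; lra.
have hcl2 : 100 <= (1 - c) * l.
  have [h _] := powers_large hcl; apply: le_trans h _.
  by rewrite ler_wpM2r ?(ltW lp) // ler_piMl ?(ltW c1) //; lra.
have -> : ln (ln m%:R) `^ 6 = l ^+ 6 by rewrite -/l powR_mulrn // ltW.
have -> : l ^+ 6 / ln m%:R `^ 2^-1 = l ^+ 6 * expR (- (l / 2)).
  by rewrite eL -expRM expRN.
have mE : m%:R = expR (expR l) :> R by rewrite -eL lnK.
have {}hN : expR (c * expR l) < N%:R by move: hN; rewrite mE -expRM mulrC.
have NR : (0 : R) < N%:R by apply: lt_trans hN; apply: expR_gt0.
set x := expR (- (l / 2)).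
have x0 : 0 < x by apply: expR_gt0.
have b0 : 0 < l ^+ 6 * x * N%:R by rewrite !mulr_gt0 // exprn_gt0.
have [Nm|mN] := leqP N m.
  apply: le_lt_trans (kloosterman_mid_le hl hc0 hcl1 eL ca (ltW hN) Nm) _.
  by rewrite -/x; lra.
apply: le_lt_trans (kloosterman_all_le hl hc0 hc1 hcl1 eL ca N) _.
(* The incomplete period costs [m ^ c], negligible against [m < N] because
   [(1 - c) * expR l >= l]. *)
have h1 : expR (c * expR l) <= expR (- l) * N%:R.
  apply: (@le_trans _ _ (expR (- l) * m%:R)); last by rewrite ler_wpM2l ?expR_ge0 // ler_nat ltnW.
  rewrite mE -expRD ler_expR.
  have hL := expR_ge_sqr hl.
  have : (1 - c) * (100 * l ^+ 2) <= (1 - c) * expR l by rewrite ler_wpM2l // ltW.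
  have : 100 * l <= (1 - c) * l ^+ 2 by rewrite expr2 mulrA ler_wpM2r // ltW.
  lra.
have h2 : expR (- l) * N%:R <= x * N%:R.
  by rewrite ler_wpM2r ?(ltW NR) // ler_expR; lra.
have h3 : 100 * (x * N%:R) <= l ^+ 6 * (x * N%:R).
  rewrite ler_wpM2r ?mulr_ge0 ?(ltW x0) ?(ltW NR) //.
  apply: le_trans l1 _; rewrite exprS ler_peMr ?(ltW lp) // exprn_ege1 //; lra.
have xN : 0 < x * N%:R by rewrite mulr_gt0.
by move: h1 h2 h3 b0; rewrite -/x; lra.
Qed.
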